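(* Consider the $2\times2$ hydrodynamic-type system in Jordan-block form $$u^1_t=\lambda(u^1,u^2)\,u^1_x+\mu(u^1,u^2)\,u^2_x,\qquad u^2_t=\lambda(u^1,u^2)\,u^2_x,$$ where $\lambda,\mu$ are (smooth) functions of $(u^1,u^2)$ with $\mu\neq0$. The following conditions are equivalent: (i) the system is linearly degenerate; (ii) the system admits a quasilinear differential constraint $u^2_x=\varphi^1(t,x,u^1,u^2)$; (iii) the system admits a Hamiltonian formalism in the Dubrovin–Novikov sense.
   Context: Write $\mathbf{u}=(u^1,u^2)$ and $A=\begin{pmatrix}\lambda&\mu\\0&\lambda\end{pmatrix}$, so the system is $u^i_t=A^i_j(\mathbf{u})u^j_x$ (summation over repeated indices). Existence in (ii) and (iii) is understood locally. Linear degeneracy: with $\det(z\mathbb{I}-A)=z^2+f_1(\mathbf{u})z+f_2(\mathbf{u})$, the system is linearly degenerate if $\nabla f_1\,A+\nabla f_2=0$ identically, where $\nabla f=(\partial f/\partial u^1,\partial f/\partial u^2)$ is a row vector. Condition (ii): there is a function $\varphi=\varphi^1(t,x,u^1,u^2)$ such that the constraint $u^2_x=\varphi$ is compatible with the system, meaning that $u^2_{xt}=u^2_{tx}$ holds identically modulo the system and the constraint, i.e. $$\varphi_t+\varphi_{u^1}(\lambda p+\mu\varphi)+\varphi_{u^2}\lambda\varphi=(\lambda\varphi)_x+(\lambda\varphi)_{u^1}p+(\lambda\varphi)_{u^2}\varphi$$ for all $(x,t,\mathbf{u})$ in the domain and all values of $p=u^1_x$, where subscripts denote partial derivatives in the independent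 arguments $x,t,u^1,u^2$. Condition (iii): there exist a function $h(\mathbf{u})$ (density of a Hamiltonian functional $H=\int h(\mathbf{u})\,dx$) and a Hamiltonian operator of Dubrovin–Novikov form $P^{ij}=g^{ij}(\mathbf{u})\partial_x+b^{ij}_k(\mathbf{u})u^k_x$ with $\det(g^{ij})\ne0$ such that $$A^i_j(\mathbf{u})u^j_x=P^{ij}\frac{\partial h}{\partial u^j},\qquad i=1,2.$$ Such a non-degenerate operator is Hamiltonian when $g^{ij}$ is symmetric, its inverse $g_{ij}$ is a flat (pseudo-Riemannian) metric, and $b^{ij}_k=-g^{is}\Gamma^j_{sk}$, with $\Gamma^j_{sk}$ the Christoffel symbols of the Levi-Civita connection of $g_{ij}$.
   Formalization: In (ii) the constraint function φ¹ is required not to vanish identically near the base point: φ¹ = 0 is compatible with every system, so without this (ii) would always hold and (ii)⇒(i) would fail, e.g. for λ = u¹, μ = 1. *)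

(* Defs.v *)
From HB Require Import structures.
From mathcomp Require Import all_boot all_order all_algebra.
From mathcomp Require Import all_classical all_reals all_analysis.

Set Implicit Arguments.
Unset Strict Implicit.
Unset Printing Implicit Defensive.

Import Order.TTheory GRing.Theory Num.Theory.
Import numFieldNormedType.Exports.

Local Open Scope classical_set_scope.
Local Open Scope ring_scope.

Section Calculus.
Variables (R : realType) (n : nat).
Implicit Types (W : set 'rV[R]_n) (f : 'rV[R]_n -> R).

Definition partial (i : 'I_n) f : 'rV[R]_n -> R :=
  fun x => 'D_(delta_mx 0 i : 'rV[R]_n) f x.

Definition gradient f (x : 'rV[R]_n) : 'rV[R]_n := \row_j partial j f x.

(* Meaningful for open [W]; the values of [f] outside [W] are then irrelevant. *)
Fixpoint Ck (k : nat) W f : Prop :=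
  (forall x, W x -> {for x, continuous f}) /\
  (if k is k'.+1 then
     forall i : 'I_n,
       (forall x, W x -> derivable f x (delta_mx 0 i : 'rV[R]_n)) /\
       Ck k' W (partial i f)
   else True).

Definition smooth W f : Prop := forall k, Ck k W f.

End Calculus.

Section DubrovinNovikov.
Variables (R : realType) (n : nat).
Implicit Types (V : set 'rV[R]_n) (G g : 'rV[R]_n -> 'M[R]_n).

(* Christoffel symbol Gamma^j_{sk} of the covariant metric [G]. *)
Definition christoffel G (j s k : 'I_n) (u : 'rV[R]_n) : R :=
  2^-1 * \sum_l invmx (G u) j l *
    (partial s (fun v => G v l k) u + partial k (fun v => G v l s) u
     - partial l (fun v => G v s k) u).

(* Curvature component R^l_{ijk}, of d_j Gamma^l_{ki} - d_k Gamma^l_{ji} + ... *)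
Definition riemann G (l i j k : 'I_n) (u : 'rV[R]_n) : R :=
  partial j (christoffel G l k i) u - partial k (christoffel G l j i) u
  + \sum_m (christoffel G l j m u * christoffel G m k i u
            - christoffel G l k m u * christoffel G m j i u).

Definition flat_metric V G : Prop :=
  forall u, V u -> forall l i j k, riemann G l i j k u = 0.

(* g^{ij} D_x + b^{ij}_k u^k_x, where [g u i j] is the contravariant g^{ij} and
   [b u i j k] is b^{ij}_k. *)
Definition nondegenerate_hamiltonian V g
    (b : 'rV[R]_n -> 'I_n -> 'I_n -> 'I_n -> R) : Prop :=
  let G := fun u => invmx (g u) in
  [/\ forall i j, smooth V (fun u => g u i j),
      forall u, V u -> \det (g u) != 0,
      forall u, V u -> (g u)^T = g u,
      flat_metric V G &
      forall u, V u -> forall i j k,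
        b u i j k = - \sum_s g u i s * christoffel G j s k u].

(* Component i of P(dh/du) at a point of the first jet space: [p] is the
   value of u_x, and D_x f(u) = \sum_k (df/du^k) u^k_x. *)
Definition dn_flow g (b : 'rV[R]_n -> 'I_n -> 'I_n -> 'I_n -> R)
    (h : 'rV[R]_n -> R) (i : 'I_n) (u p : 'rV[R]_n) : R :=
  \sum_j (g u i j * (\sum_k partial k (partial j h) u * p 0 k)
          + (\sum_k b u i j k * p 0 k) * partial j h u).

(* Existence is local: in a neighbourhood of each point of [U]. *)
Definition admits_dn_hamiltonian (U : set 'rV[R]_n)
    (A : 'rV[R]_n -> 'M[R]_n) : Prop :=
  forall u0, U u0 ->
  exists V : set 'rV[R]_n, [/\ open V, V u0, V `<=` U &
  exists (g : 'rV[R]_n -> 'M[R]_n)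
         (b : 'rV[R]_n -> 'I_n -> 'I_n -> 'I_n -> R)
         (h : 'rV[R]_n -> R),
    [/\ nondegenerate_hamiltonian V g b, smooth V h &
        forall u (p : 'rV[R]_n), V u -> forall i,
          \sum_j A u i j * p 0 j = dn_flow g b h i u p]].

End DubrovinNovikov.

Section Systems.
Variable R : realType.
Implicit Types (U : set 'rV[R]_2) (lam mu : 'rV[R]_2 -> R).

Definition jordan_mx lam mu (u : 'rV[R]_2) : 'M[R]_2 :=
  (lam u)%:M + mu u *: delta_mx 0 1.

Definition linearly_degenerate U (A : 'rV[R]_2 -> 'M[R]_2) : Prop :=
  let f1 := fun u => (char_poly (A u))`_1 in
  let f2 := fun u => (char_poly (A u))`_0 in
  forall u, U u -> gradient f1 u *m A u + gradient f2 u = 0.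

(* The space of (t, x, u^1, u^2) is 'rV_(2 + 2), and [rsubmx z] is u. *)
Definition t_ : 'I_(2 + 2) := lshift 2 (0 : 'I_2).
Definition x_ : 'I_(2 + 2) := lshift 2 (1 : 'I_2).
Definition u1_ : 'I_(2 + 2) := rshift 2 (0 : 'I_2).
Definition u2_ : 'I_(2 + 2) := rshift 2 (1 : 'I_2).

(* u^2_xt = u^2_tx modulo the system and u^2_x = phi; [p] stands for u^1_x. *)
Definition compatible_constraint (W : set 'rV[R]_(2 + 2)) lam mu
    (phi : 'rV[R]_(2 + 2) -> R) : Prop :=
  let l := fun z : 'rV[R]_(2 + 2) => lam (rsubmx z) in
  let m := fun z : 'rV[R]_(2 + 2) => mu (rsubmx z) in
  let lphi := fun z => l z * phi z in
  forall z p, W z ->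
    partial t_ phi z + partial u1_ phi z * (l z * p + m z * phi z)
      + partial u2_ phi z * (l z * phi z)
    = partial x_ lphi z + partial u1_ lphi z * p + partial u2_ lphi z * phi z.

(* Existence is local. The function phi = 0 is compatible with every system, so
   a constraint has to be nontrivial: phi does not vanish identically near the
   given point. Nontriviality on [W] alone would not do, as smooth functions
   have no unique continuation. *)
Definition admits_quasilinear_constraint U lam mu : Prop :=
  forall z0 : 'rV[R]_(2 + 2), U (rsubmx z0) ->
  exists W : set 'rV[R]_(2 + 2),
    [/\ open W, W z0, (forall z, W z -> U (rsubmx z)) &
    exists phi : 'rV[R]_(2 + 2) -> R,
      [/\ smooth W phi, ~ (\forall z \near z0, phi z = 0) &
          compatible_constraint W lam mu phi]].

End Systems.

(* Main.v *)
Require Import Defs.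
From HB Require Import structures.
From mathcomp Require Import all_boot all_order all_algebra.
From mathcomp Require Import all_classical all_reals all_analysis.
From mathcomp Require Import ring lra.

Set Implicit Arguments.
Unset Strict Implicit.
Unset Printing Implicit Defensive.

Import Order.TTheory GRing.Theory Num.Theory.
Import numFieldNormedType.Exports.

Local Open Scope classical_set_scope.
Local Open Scope ring_scope.

(** With subscripts for partial derivatives, linear degeneracy says
    [-2 mu lambda_1 = 0], that is, [lambda = lambda(u^2)].

    (ii) The coefficient of [p] in the compatibility condition is
    [lambda_1 phi = 0]. Conversely, if [lambda = lambda(u^2)] the second equation
    is the Hopf equation for [u^2], and [phi = 1 / (1 - lambda_2 (t - t0))] is the
    blow-up law of its slope along characteristics.

    (iii) The flow is Hamiltonian with density [h] iff [G A] is the covariant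
    Hessian of [h], [G] being the flat covariant metric. Symmetry of [G A] forces
    [G_11 = 0]. Then, with [k = h_1], [b = G_12], [P = Gamma^1_11] and
    [Q = Gamma^1_12], one gets [k_1 = P k], [k_2 = Q k + b lambda], [b_1 = P b],
    and flatness reads [P_2 = Q_1]; hence [k_12 = k_21] gives [b lambda_1 = 0].
    Conversely, let [G = 2 dy du^2] and [h = y L(u^2) + K(u^2)] with
    [L' = lambda]; the only remaining equation is
    [mu y_1 = lambda_2 y + K'']. If [y_1 = exp (lambda_2 F) / mu] with
    [F_1 = 1 / mu], then [mu y_1 - lambda_2 y] depends on [u^2] only, which
    determines [K]. Indices in the code start at 0. *)

(** * Directional and partial derivatives *)

Section DirectionalDerivatives.
Variables (R : realType) (V : normedModType R).
Implicit Types (f : V -> R) (x v : V).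

(** Both difference quotients are the same function of the step. Calculus along a direction thus
    reduces to one real variable, where the chain rule and the mean value theorem are available. *)
Lemma is_derive_line f x v (s d : R) :
  is_derive (s *: v + x) v f d <-> is_derive s 1 (fun t => f (t *: v + x)) d.
Proof.
have E : (fun h : R => h^-1 *: ((f \o shift (s *: v + x)) (h *: v) - f (s *: v + x))) =
    (fun h => h^-1 *: (((fun t => f (t *: v + x)) \o shift s) (h *: (1 : R))
                - f (s *: v + x))).
  by apply/funext => h /=; rewrite addrA -scalerDl [h%:A]mulr1.
by split=> -[df dv]; split; move: df dv; rewrite /derivable /derive E.
Qed.

Lemma is_derive_line0 f x v (d : R) :
  is_derive x v f d <-> is_derive (0 : R) 1 (fun t => f (t *: v + x)) d.
Proof. by have := is_derive_line f x v 0 d; rewrite scale0r add0r. Qed.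

Lemma is_derive_scale_dir f x v (c d : R) :
  is_derive x v f d -> is_derive x (c *: v) f (c * d).
Proof.
move=> /is_derive_line0 fd; apply/is_derive_line0.
have -> : (fun t : R => f (t *: (c *: v) + x)) =
          (fun t => f (t *: v + x)) \o (fun t => c * t).
  by apply/funext => t /=; rewrite scalerA mulrC.
have f0 : is_derive (c * 0) 1 (fun t => f (t *: v + x)) d by rewrite mulr0.
have c0 : is_derive (0 : R) 1 (fun t : R => c * t) c.
  have -> : (fun t => c * t) = c \*: (id : R -> R) by [].
  by apply: is_derive_eq; exact: mulr1.
by rewrite mulrC; exact: (@is_derive1_comp R _ _ 0 _ _ f0 c0).
Qed.

(** Derivability along [v] on the closed segment also supplies the continuity at the endpoints that
    the one-variable mean value theorem asks for. *)
Lemma MVT_dir f x v :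
  (forall t : R, 0 <= t <= 1 -> derivable f (t *: v + x) v) ->
  exists2 t : R, 0 <= t <= 1 & f (v + x) - f x = 'D_v f (t *: v + x).
Proof.
move=> df.
pose g (t : R) := f (t *: v + x).
have dg (t : R) : 0 <= t <= 1 -> is_derive t 1 g ('D_v f (t *: v + x)).
  by move=> t01; apply/is_derive_line/derivableP/df.
have cg : {within `[0, 1], continuous g}.
  apply: derivable_within_continuous => t; rewrite in_itv /= => t01.
  by have [] := dg t t01.
have [||t] := @MVT_segment R g (fun t => 'D_v f (t *: v + x)) 0 1 ler01.
- by move=> t; rewrite in_itv /= => /andP[? ?]; apply: dg; rewrite !ltW.
- exact: cg.
rewrite in_itv /= => t01; rewrite /g scale1r scale0r add0r subr0 mulr1 => E.
by exists t.
Qed.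

End DirectionalDerivatives.

Section Partials.
Variables (R : realType) (n : nat).
Implicit Types (W : set 'rV[R]_n) (f g : 'rV[R]_n -> R).

Local Notation e i := (delta_mx 0 i : 'rV[R]_n).

Lemma near_open W (P : 'rV[R]_n -> Prop) x :
  open W -> W x -> (forall y, W y -> P y) -> \forall y \near x, P y.
Proof.
move=> oW Wx WP; apply: (filterS (P := W)) => //.
exact: open_nbhs_nbhs.
Qed.

Lemma eq_partial W f g i x : open W -> (forall y, W y -> f y = g y) -> W x ->
  partial i f x = partial i g x.
Proof. by move=> oW fg Wx; apply: near_eq_derive; exact: (near_open oW Wx fg). Qed.

Lemma partialD f g i x : derivable f x (e i) -> derivable g x (e i) ->
  partial i (fun u => f u + g u) x = partial i f x + partial i g x.
Proof. by move=> df dg; rewrite /partial; exact: (deriveD df dg). Qed.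

Lemma partialM f g i x : derivable f x (e i) -> derivable g x (e i) ->
  partial i (fun u => f u * g u) x = f x * partial i g x + partial i f x * g x.
Proof.
move=> df dg; rewrite /partial (deriveM df dg) [X in _ + X]mulrC.
by [].
Qed.

Lemma partialV f i x : f x != 0 -> derivable f x (e i) ->
  partial i (fun u => (f u)^-1) x = - (f x) ^- 2 * partial i f x.
Proof. by move=> f0 df; rewrite /partial; exact: (deriveV f0 df). Qed.

Lemma partial_cst (c : R) i (x : 'rV[R]_n) : partial i (fun=> c) x = 0.
Proof. exact: derive_cst. Qed.

Lemma is_derive_expR_comp f i x : derivable f x (e i) ->
  is_derive x (e i) (fun u => expR (f u)) (expR (f x) * partial i f x).
Proof.
move=> /derivableP df; apply/is_derive_line0.
pose g (t : R) := f (t *: e i + x).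
have h : is_derive (0 : R) 1 g (partial i f x).
  exact: (is_derive_line0 f x (e i) _).1.
have := @is_derive1_comp R expR g 0 _ _ (is_derive_expR (g 0)) h.
by rewrite /g scale0r add0r.
Qed.

Lemma is_derive_coord (j i : 'I_n) (x : 'rV[R]_n) :
  is_derive x (e i) (fun u => u 0 j) (i == j)%:R.
Proof.
apply: (is_derive_line0 (fun u : 'rV[R]_n => u 0 j) x (e i) _).2.
have -> : (fun t : R => (t *: e i + x) 0 j) = (i == j)%:R \*: id + cst (x 0 j).
  by apply/funext => t; rewrite /= !mxE eqxx eq_sym mulrC.
apply: is_derive_eq; rewrite addr0; exact: mulr1.
Qed.

End Partials.

(** * Closure properties of smooth functions *)

Section SmoothFunctions.
Variables (R : realType) (n : nat).
Implicit Types (W : set 'rV[R]_n) (f g : 'rV[R]_n -> R).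

Local Notation e i := (delta_mx 0 i : 'rV[R]_n).

(** On an open set, agreement on [W] is agreement near each of its points, which preserves limits
    and derivatives. The inductions below use this to replace a partial derivative by an explicit
    formula. *)
Lemma eq_Ck k W f g : open W -> (forall x, W x -> f x = g x) ->
  Ck k W f -> Ck k W g.
Proof.
elim: k f g => [|k IH] f g oW fg [cf df]; split.
- move=> x Wx; rewrite /prop_for /continuous_at -fg //.
  apply: cvg_trans (cf x Wx); apply: near_eq_cvg.
    exact: (nbhs_filter x).
  exact: (near_open oW Wx fg).
- by [].
- move=> x Wx; rewrite /prop_for /continuous_at -fg //.
  apply: cvg_trans (cf x Wx); apply: near_eq_cvg.
    exact: (nbhs_filter x).
  exact: (near_open oW Wx fg).
- move=> i; have [dfi Ci] := df i; split.
    move=> x Wx; apply: near_eq_derivable (dfi x Wx); exact: (near_open oW Wx fg).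
  apply: IH Ci => // x Wx; exact: (eq_partial _ oW fg Wx).
Qed.

Lemma CkW k W f : Ck k.+1 W f -> Ck k W f.
Proof.
elim: k f => [|k IH] f; first by case.
move=> [cf df]; split=> // i; have [dfi Ci] := df i; split=> //; exact: IH.
Qed.

Lemma sub_Ck k W W' f : W' `<=` W -> Ck k W f -> Ck k W' f.
Proof.
move=> sW; elim: k f => [|k IH] f [cf df]; split=> //.
- by move=> x /sW; exact: cf.
- by move=> x /sW; exact: cf.
- by move=> i; have [dfi Ci] := df i; split; [move=> x /sW; exact: dfi|exact: IH].
Qed.

Lemma Ck_cst k W (c : R) : Ck k W (fun=> c).
Proof.
elim: k c => [|k IH] c; split=> //; try by move=> x _; exact: cst_continuous.
move=> i; split; first by move=> x _; exact: derivable_cst.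
have -> : partial i (fun=> c) = fun=> 0 by apply/funext => x; exact: partial_cst.
exact: IH.
Qed.

Lemma CkD k W f g : open W -> Ck k W f -> Ck k W g ->
  Ck k W (fun u => f u + g u).
Proof.
move=> oW; elim: k f g => [|k IH] f g [cf df] [cg dg]; split=> //;
  try by move=> x Wx; apply: continuousD; [exact: cf|exact: cg].
move=> i; have [dfi Cfi] := df i; have [dgi Cgi] := dg i; split.
  by move=> x Wx; apply: derivableD; [exact: dfi|exact: dgi].
apply: (@eq_Ck _ _ (fun u => partial i f u + partial i g u)) => //.
  by move=> x Wx; rewrite partialD //; [exact: dfi|exact: dgi].
exact: IH.
Qed.

Lemma CkM k W f g : open W -> Ck k W f -> Ck k W g ->
  Ck k W (fun u => f u * g u).
Proof.
move=> oW; elim: k f g => [|k IH] f g Cf Cg; have [cf df] := Cf;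
  have [cg dg] := Cg; split=> //;
  try by move=> x Wx; apply: continuousM; [exact: cf|exact: cg].
move=> i; have [dfi Cfi] := df i; have [dgi Cgi] := dg i; split.
  by move=> x Wx; apply: derivableM; [exact: dfi|exact: dgi].
apply: (@eq_Ck _ _ (fun u => f u * partial i g u + partial i f u * g u)) => //.
  by move=> x Wx; rewrite partialM //; [exact: dfi|exact: dgi].
(* The Leibniz formula contains [f] and [g] undifferentiated; [CkW] lowers them to the order of the
   induction hypothesis. *)
by apply: CkD => //; apply: IH => //; exact: CkW.
Qed.

Lemma CkV k W f : open W -> (forall x, W x -> f x != 0) -> Ck k W f ->
  Ck k W (fun u => (f u)^-1).
Proof.
move=> oW f0; elim: k => [|k IH] Cf; have [cf df] := Cf; split=> //;
  try by move=> x Wx; apply: continuousV; [exact: f0|exact: cf].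
move=> i; have [dfi Cfi] := df i; split.
  by move=> x Wx; apply: derivableV; [exact: f0|exact: dfi].
(* The derivative of the inverse is written as a product, so that [CkM] and the induction hypothesis
   on the inverse apply. *)
apply: (@eq_Ck _ _ (fun u => - 1 * ((f u)^-1 * (f u)^-1) * partial i f u)) => //.
  move=> x Wx; rewrite partialV //; [|exact: f0|exact: dfi].
  by rewrite expr2 invfM mulN1r.
have CV := IH (CkW Cf).
by do 2 apply: CkM => //; [exact: Ck_cst|exact: CkM].
Qed.

Lemma Ck_expR k W f : open W -> Ck k W f -> Ck k W (fun u => expR (f u)).
Proof.
move=> oW.
have cexp (x : 'rV[R]_n) : {for x, continuous f} ->
    {for x, continuous (fun u => expR (f u))}.
  by move=> cf; apply: (@continuous_comp _ _ _ f expR x) => //; exact: continuous_expR.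
elim: k => [|k IH] Cf; have [cf df] := Cf; split=> //;
  try by move=> x Wx; apply: cexp; exact: cf.
move=> i; have [dfi Cfi] := df i; split.
  by move=> x Wx; have [] := is_derive_expR_comp (dfi x Wx).
apply: (@eq_Ck _ _ (fun u => expR (f u) * partial i f u)) => //.
  by move=> x Wx; have [_] := is_derive_expR_comp (dfi x Wx).
by apply: CkM => //; exact: IH (CkW Cf).
Qed.

Lemma Ck_coord k W j : Ck k W (fun u => u 0 j).
Proof.
case: k => [|k]; split=> //; try by move=> x _; exact: coord_continuous.
move=> i; split; first by move=> x _; have [] := is_derive_coord j i x.
have -> : partial i (fun u : 'rV[R]_n => u 0 j) = fun=> (i == j)%:R.
  by apply/funext => x; have [] := is_derive_coord j i x.
exact: Ck_cst.
Qed.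

Lemma smooth_continuous W f x : smooth W f -> W x -> {for x, continuous f}.
Proof. by move=> sf Wx; have [cf _] := sf 0%N; exact: cf. Qed.

Lemma smooth_derivable W f i x : smooth W f -> W x -> derivable f x (e i).
Proof. by move=> sf Wx; have [_ /(_ i)[df _]] := sf 1%N; exact: df. Qed.

Lemma smooth_partial W f i : smooth W f -> smooth W (partial i f).
Proof. by move=> sf k; have [_ /(_ i)[]] := sf k.+1. Qed.

Lemma sub_smooth W W' f : W' `<=` W -> smooth W f -> smooth W' f.
Proof. by move=> sW sf k; exact: sub_Ck (sf k). Qed.

Lemma eq_smooth W f g : open W -> (forall x, W x -> f x = g x) ->
  smooth W f -> smooth W g.
Proof. by move=> oW fg sf k; exact: eq_Ck (sf k). Qed.

Lemma smooth_cst W (c : R) : smooth W (fun=> c).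
Proof. by move=> k; exact: Ck_cst. Qed.

Lemma smooth_coord W j : smooth W (fun u => u 0 j).
Proof. by move=> k; exact: Ck_coord. Qed.

Lemma smoothD W f g : open W -> smooth W f -> smooth W g ->
  smooth W (fun u => f u + g u).
Proof. by move=> oW sf sg k; exact: CkD. Qed.

Lemma smoothM W f g : open W -> smooth W f -> smooth W g ->
  smooth W (fun u => f u * g u).
Proof. by move=> oW sf sg k; exact: CkM. Qed.

Lemma smoothN W f : open W -> smooth W f -> smooth W (fun u => - f u).
Proof.
move=> oW sf; have -> : (fun u => - f u) = fun u => -1 * f u.
  by apply/funext => u; rewrite mulN1r.
by apply: smoothM => //; exact: smooth_cst.
Qed.

Lemma smoothV W f : open W -> (forall x, W x -> f x != 0) -> smooth W f ->
  smooth W (fun u => (f u)^-1).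
Proof. by move=> oW f0 sf k; exact: CkV. Qed.

Lemma smooth_expR W f : open W -> smooth W f -> smooth W (fun u => expR (f u)).
Proof. by move=> oW sf k; exact: Ck_expR. Qed.

Lemma smooth_sum (I : Type) (r : seq I) (P : pred I) W (F : I -> 'rV[R]_n -> R) :
  open W -> (forall i, smooth W (F i)) ->
  smooth W (fun u => \sum_(i <- r | P i) F i u).
Proof.
move=> oW sF; elim: r => [|i r IH].
  by apply: (eq_smooth oW _ (smooth_cst W 0)) => x _; rewrite big_nil.
apply: (eq_smooth (f := fun u => (if P i then F i u else 0) +
    \sum_(i <- r | P i) F i u) oW) => [x _|].
  by rewrite big_cons; case: ifP; rewrite ?add0r.
by apply: smoothD => //; case: (P i) => //; exact: smooth_cst.
Qed.

Lemma smooth_prod (I : Type) (r : seq I) (P : pred I) W (F : I -> 'rV[R]_n -> R) :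
  open W -> (forall i, smooth W (F i)) ->
  smooth W (fun u => \prod_(i <- r | P i) F i u).
Proof.
move=> oW sF; elim: r => [|i r IH].
  by apply: (eq_smooth oW _ (smooth_cst W 1)) => x _; rewrite big_nil.
apply: (eq_smooth (f := fun u => (if P i then F i u else 1) *
    \prod_(i <- r | P i) F i u) oW) => [x _|].
  by rewrite big_cons; case: ifP; rewrite ?mul1r.
by apply: smoothM => //; case: (P i) => //; exact: smooth_cst.
Qed.

End SmoothFunctions.

(** * Symmetry of second derivatives *)

Section SecondDerivatives.
Variables (R : realType) (n : nat).
Implicit Types (W : set 'rV[R]_n) (f g : 'rV[R]_n -> R).

Local Notation e i := (delta_mx 0 i : 'rV[R]_n).

Lemma is_derive_translate f (w x v : 'rV[R]_n) (d : R) :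
  is_derive (w + x) v f d -> is_derive x v (fun y => f (w + y)) d.
Proof.
have E : (fun h : R => h^-1 *: ((f \o shift (w + x)) (h *: v) - f (w + x))) =
    (fun h => h^-1 *: (((fun y => f (w + y)) \o shift x) (h *: v) - f (w + x))).
  by apply/funext => h /=; rewrite addrCA.
by move=> [df dv]; split; move: df dv; rewrite /derivable /derive E.
Qed.

(** Two applications of the mean value theorem: first to the increment [f (t *: e j + y) - f y]
    along [t *: e i], then to [partial i f] along [t *: e j]. The hypothesis keeps the whole
    parallelogram in [W]. *)
Lemma second_difference W f (i j : 'I_n) (x : 'rV[R]_n) (t : R) :
  smooth W f ->
  (forall s s' : R, 0 <= s <= 1 -> 0 <= s' <= 1 ->
     W (s *: (t *: e j) + (s' *: (t *: e i) + x))) ->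
  exists s s' : R, [/\ 0 <= s <= 1, 0 <= s' <= 1 &
    f (t *: e j + (t *: e i + x)) - f (t *: e i + x)
      - (f (t *: e j + x) - f x) =
    t * t * partial j (partial i f) (s *: (t *: e j) + (s' *: (t *: e i) + x))].
Proof.
move=> sf WW.
have W0 s' : 0 <= s' <= 1 -> W (s' *: (t *: e i) + x).
  move=> s01; have := WW 0 s' _ s01.
  by rewrite scale0r add0r; apply; rewrite lexx ler01.
have W1 s' : 0 <= s' <= 1 -> W (t *: e j + (s' *: (t *: e i) + x)).
  move=> s01; have := WW 1 s' _ s01.
  by rewrite scale1r; apply; rewrite lexx ler01.
have dscale g y k : smooth W g -> W y ->
    is_derive y (t *: e k) g (t * partial k g y).
  move=> sg Wy; apply: is_derive_scale_dir; apply: derivableP.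
  exact: smooth_derivable sg Wy.
pose g y := f (t *: e j + y) - f y.
have dg s : 0 <= s <= 1 -> is_derive (s *: (t *: e i) + x) (t *: e i) g
    (t * partial i f (t *: e j + (s *: (t *: e i) + x))
     - t * partial i f (s *: (t *: e i) + x)).
  move=> s01; apply: is_deriveB; last by apply: dscale => //; exact: W0.
  by apply: is_derive_translate; apply: dscale => //; exact: W1.
have [s0 s001 E] := @MVT_dir R _ g x (t *: e i)
  (fun s s01 => @ex_derive _ _ _ _ _ _ _ (dg s s01)).
have [_ E'] := dg s0 s001.
pose z := s0 *: (t *: e i) + x.
have dgi s : 0 <= s <= 1 -> is_derive (s *: (t *: e j) + z) (t *: e j) (partial i f)
    (t * partial j (partial i f) (s *: (t *: e j) + z)).
  by move=> s01; apply: dscale; [exact: smooth_partial|exact: WW].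
have [s1 s101 E1] := @MVT_dir R _ (partial i f) z (t *: e j)
  (fun s s01 => @ex_derive _ _ _ _ _ _ _ (dgi s s01)).
have [_ E1'] := dgi s1 s101.
exists s1, s0; split=> //.
have -> : f (t *: e j + (t *: e i + x)) - f (t *: e i + x) - (f (t *: e j + x) - f x)
        = g (t *: e i + x) - g x by [].
by rewrite E E' -mulrBr -/z E1 E1' mulrA.
Qed.

(** The second difference of [f] over a small parallelogram is symmetric in [i] and [j], so one
    mixed derivative at some point near [x] equals the other one at another such point. By
    continuity their values at [x] then differ by less than [eps + eps], which is the assumed
    difference itself. *)
Lemma partialC W f (i j : 'I_n) x : open W -> smooth W f -> W x ->
  partial i (partial j f) x = partial j (partial i f) x.
Proof.
move=> oW sf Wx; apply/eqP; rewrite -subr_eq0; apply/negP => /negP.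
set A := partial i _; set B := partial j _ => AB.
pose eps := `|A x - B x| / 2.
have eps0 : 0 < eps by rewrite divr_gt0 // normr_gt0.
have cA : {for x, continuous A}.
  exact: (smooth_continuous (smooth_partial i (smooth_partial j sf)) Wx).
have cB : {for x, continuous B}.
  exact: (smooth_continuous (smooth_partial j (smooth_partial i sf)) Wx).
have nearx : \forall y \near x, [/\ W y, `|A x - A y| < eps & `|B x - B y| < eps].
  have nA : \forall y \near x, `|A x - A y| < eps 
    by move/cvgrPdist_lt : cA => /(_ _ eps0).
  have nB : \forall y \near x, `|B x - B y| < eps 
    by move/cvgrPdist_lt : cB => /(_ _ eps0).
  have nW : \forall y \near x, W y by exact: (near_open oW Wx).
  exact: (@filterS3 _ _ (nbhs_filter x) _ _ _ _
    (fun y h1 h2 h3 => And3 h1 h2 h3) nW nA nB).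
have /nbhs_ballP[r /= r0 rP] := nearx.
(* A side length small enough for the parallelogram to fit in the ball; the [+ 1] below makes the
   denominator positive and the bound strict. *)
have [t t0 tr] : exists2 t : R, 0 < t & t * (`|e i| + `|e j|) < r.
  have D0 : 0 < `|e i| + `|e j| + 1 by rewrite ltr_wpDl ?addr_ge0.
  exists (r / (`|e i| + `|e j| + 1)); first by rewrite divr_gt0.
  by rewrite mulrAC ltr_pdivrMr // ltr_pM2l // ltrDl.
have inball k l (s s' : R) : 0 <= s <= 1 -> 0 <= s' <= 1 ->
    `|e k| + `|e l| = `|e i| + `|e j| ->
    ball x r (s *: (t *: e k) + (s' *: (t *: e l) + x)).
  move=> /andP[s0 s1] /andP[s'0 s'1] kl; rewrite -ball_normE /ball_ /=.
  rewrite addrA [_ + x]addrC opprD addNKr normrN.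
  apply: le_lt_trans (ler_normD _ _) _; rewrite !normrZ (ger0_norm s0) (ger0_norm s'0).
  rewrite (gtr0_norm t0).
  have te y : 0 <= t * `|e y| by rewrite mulr_ge0 // ltW.
  have h1 := ler_wpM2r (te k) s1; have h2 := ler_wpM2r (te l) s'1.
  by apply: le_lt_trans (lerD h1 h2) _; rewrite !mul1r -mulrDr kl.
have Wij k l : `|e k| + `|e l| = `|e i| + `|e j| -> forall s s' : R,
    0 <= s <= 1 -> 0 <= s' <= 1 -> W (s *: (t *: e k) + (s' *: (t *: e l) + x)).
  by move=> kl s s' s01 s'01; have [] := rP _ (inball k l s s' s01 s'01 kl).
have [s [s' [s01 s'01 E]]] := second_difference sf (Wij j i (addrC _ _)).
have [q [q' [q01 q'01 E']]] := second_difference sf (Wij i j erefl).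
have tt : t * t != 0 by rewrite mulf_neq0 // gt_eqF.
(* Both second differences are the same alternating sum of [f] over the four corners, so the factor
   [t * t] cancels. *)
have {E E'} : A (q *: (t *: e i) + (q' *: (t *: e j) + x)) =
         B (s *: (t *: e j) + (s' *: (t *: e i) + x)).
  apply: (mulfI tt); refine (etrans (esym E') (etrans _ E)).
  rewrite [t *: e i + (t *: e j + x)]addrCA.
  set a := f _; set b := f _; set c := f _; set d := f _; ring.
have [_ hA _] := rP _ (inball i j q q' q01 q'01 erefl).
have [_ _ hB] := rP _ (inball j i s s' s01 s'01 (addrC _ _)).
move=> E; rewrite E in hA.
have : `|A x - B x| < eps + eps.
  apply: le_lt_trans (ltrD hA hB).
  by rewrite [X in _ <= _ + X]distrC; exact: ler_distD.
by rewrite -splitr ltxx.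
Qed.

End SecondDerivatives.

(** * Antiderivatives depending on parameters *)

Section Boxes.
Variables (R : realType) (n : nat).
Implicit Types (f F : 'rV[R]_n -> R) (z u v : 'rV[R]_n) (r : R).

Local Notation e i := (delta_mx 0 i : 'rV[R]_n).

(** For [r > 0] this is the ball of the sup norm, in the coordinate form that suits moving or
    integrating along one coordinate. *)
Definition box z r : set 'rV[R]_n := [set u | forall j, `|z 0 j - u 0 j| < r].

Definition closed_box z r : set 'rV[R]_n :=
  [set u | forall j, `|z 0 j - u 0 j| <= r].

Lemma box_ballE z r : 0 < r -> box z r = ball z r.
Proof.
move=> r0; apply/seteqP; split=> u /=.
  by move=> zu; split=> // i j; rewrite [i]ord1; exact: zu.
by move=> [_ zu] j; exact: zu.
Qed.

Lemma box_center z r : 0 < r -> box z r z.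
Proof. by move=> r0 j; rewrite subrr normr0. Qed.

Lemma open_box z r : 0 < r -> open (box z r).
Proof. by move=> r0; rewrite box_ballE //; exact: ball_open. Qed.

Lemma sub_box_closed z r : box z r `<=` closed_box z r.
Proof. by move=> u zu j; apply/ltW/zu. Qed.

Lemma compact_closed_box z r : compact (closed_box z r).
Proof.
have -> : closed_box z r =
    [set u | forall j, `[z 0 j - r, z 0 j + r]%classic (u ord0 j)].
  by apply/seteqP; split=> u /= zu j; have := zu j; rewrite /= in_itv /= ler_distlC.
apply: (@rV_compact _ _ (fun j => `[z 0 j - r, z 0 j + r]%classic)) => j.
exact: segment_compact.
Qed.

Lemma closed_box_bounded z r f :
  {in closed_box z r, forall x, {for x, continuous f}} ->
  exists2 M, 0 <= M & forall u, closed_box z r u -> `|f u| <= M.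
Proof.
move=> cf.
have : bounded_set (f @` closed_box z r).
  apply/compact_bounded/continuous_compact; last exact: compact_closed_box.
  apply: continuous_in_subspaceT => x; exact: cf.
move=> [M [_ HM]]; exists (`|M| + 1); first by rewrite addr_ge0.
move=> u zu; apply: (HM (`|M| + 1)); last by exists u.
by rewrite (le_lt_trans (ler_norm _)) // ltrDl.
Qed.

(** Bounding both terms by the maximum of the two norms, itself below [r], keeps the inequality
    strict at [t = 0] and [t = 1] as well. *)
Lemma convex_norm_lt (t a b r : R) : 0 <= t <= 1 -> `|a| < r -> `|b| < r ->
  `|(1 - t) * a + t * b| < r.
Proof.
move=> /andP[t0 t1] ar br; pose m := Num.max `|a| `|b|.
have am : `|a| <= m by rewrite le_max lexx.
have bm : `|b| <= m by rewrite le_max lexx orbT.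
have mr : m < r by rewrite gt_max ar br.
apply: le_lt_trans mr; apply: le_trans (ler_normD _ _) _.
have t1' : 0 <= 1 - t by rewrite subr_ge0.
rewrite !normrM (ger0_norm t0) (ger0_norm t1').
have h1 := ler_wpM2l t1' am; have h2 := ler_wpM2l t0 bm.
apply: le_trans (lerD h1 h2) _; rewrite -mulrDl subrK mul1r; exact: lexx.
Qed.

Lemma box_segment z r u (v : 'rV[R]_n) (t : R) : 0 <= t <= 1 ->
  box z r u -> box z r (v + u) -> box z r (t *: v + u).
Proof.
move=> t01 zu zv j; have := convex_norm_lt t01 (zu j) (zv j).
rewrite !mxE; congr (`|_| < _); ring.
Qed.

Lemma is_derive_continuous_line f u v (s d : R) :
  is_derive (s *: v + u) v f d -> {for s, continuous (fun t : R => f (t *: v + u))}.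
Proof.
move=> /is_derive_line[df _]; apply: differentiable_continuous.
exact/derivable1_diffP.
Qed.

Lemma partial_increment z r F (M : R) i u (t : R) :
  (forall u, box z r u -> derivable F u (e i) /\ `|partial i F u| <= M) ->
  box z r u -> box z r (t *: e i + u) -> `|F (t *: e i + u) - F u| <= `|t| * M.
Proof.
move=> dF zu ztu.
have dt (s : R) : 0 <= s <= 1 -> is_derive (s *: (t *: e i) + u) (t *: e i) F
    (t * partial i F (s *: (t *: e i) + u)).
  move=> s01; apply: is_derive_scale_dir; apply: derivableP.
  by have [] := dF _ (box_segment s01 zu ztu).
have [s s01 E] := @MVT_dir R _ F u (t *: e i)
  (fun s s01 => @ex_derive _ _ _ _ _ _ _ (dt s s01)).
rewrite E; have [_ ->] := dt s s01; rewrite normrM ler_wpM2l //.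
by have [] := dF _ (box_segment s01 zu ztu).
Qed.

(* Partial derivatives alone do not give joint continuity; bounded ones do, by
   moving one coordinate at a time. *)
Lemma bounded_partials_continuous z r F (M : R) : 0 < r -> 0 <= M ->
  (forall u i, box z r u -> derivable F u (e i) /\ `|partial i F u| <= M) ->
  forall u, box z r u -> {for u, continuous F}.
Proof.
move=> r0 M0 dF u zu.
(* A path from [u] to [v]: consecutive points differ in one coordinate only, and all of them stay in
   the box. *)
pose w v k : 'rV[R]_n := \row_j (if (j < k)%N then v 0 j else u 0 j).
have zw v k : box z r v -> box z r (w v k).
  by move=> zv j; rewrite mxE; case: ifP.
have step v k (kn : (k < n)%N) :
    w v k.+1 = (v 0 (Ordinal kn) - u 0 (Ordinal kn)) *: e (Ordinal kn) + w v k.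
  apply/rowP => j; rewrite !mxE eqxx /= ltnS leq_eqVlt -val_eqE /=.
  have [jk|jk] /= := eqVneq (j : nat) k; last by rewrite mulr0 add0r.
  have -> : Ordinal kn = j by exact: val_inj.
  by rewrite jk ltnn mulr1 subrK.
have bound v (d : R) : box z r v -> (forall j, `|u 0 j - v 0 j| <= d) ->
    forall k, (k <= n)%N -> `|F (w v k) - F u| <= k%:R * (d * M).
  move=> zv vd; elim=> [|k IH] kn.
    have -> : w v 0%N = u by apply/rowP => j; rewrite mxE.
    by rewrite subrr normr0 mul0r.
  rewrite -natr1 mulrDl mul1r [leRHS]addrC.
  apply: le_trans (ler_distD (F (w v k)) _ _) _; apply: lerD; last exact/IH/ltnW.
  have zk := zw v k zv; have zk1 := zw v k.+1 zv; rewrite (step v k kn) in zk1 *.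
  apply: le_trans (partial_increment (fun y => dF y _) zk zk1) _.
  by rewrite ler_wpM2r // distrC.
apply/(@cvgrPdist_lt _ _ _ (nbhs u) (nbhs_filter u)) => eps eps0.
(* Chosen so that the [n] increments, each at most [d * M], add up to less than [eps]; the [+ 1]
   covers the case [n%:R * M = 0]. *)
pose d := eps / (n%:R * M + 1).
have D0 : 0 < n%:R * M + 1 by rewrite ltr_wpDl // mulr_ge0.
have d0 : 0 < d by rewrite divr_gt0.
have nz : \forall v \near u, box z r v.
  exact: (near_open (@open_box z r r0) zu (fun y h => h)).
have nd : \forall v \near u, box u d v.
  exact: (near_open (@open_box u d d0) (@box_center u d d0) (fun y h => h)).
apply: (@filterS2 _ _ (nbhs_filter u) _ _ _ _ nz nd) => v zv uv.
have -> : v = w v n by apply/rowP => j; rewrite mxE ltn_ord.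
rewrite distrC.
apply: le_lt_trans (bound v d zv (fun j => ltW (uv j)) n (leqnn n)) _.
by rewrite mulrCA /d mulrAC ltr_pdivrMr // ltr_pM2l // ltrDl.
Qed.

End Boxes.

(** * Integration along one coordinate of a box *)

Section ParametricIntegral.
Variables (R : realType) (n : nat) (i : 'I_n) (z : 'rV[R]_n) (r : R).
Variable U : set 'rV[R]_n.
Hypotheses (r_gt0 : 0 < r) (sub_boxU : closed_box z r `<=` U).
Implicit Types (f F : 'rV[R]_n -> R) (u v : 'rV[R]_n).

Local Notation e j := (delta_mx 0 j : 'rV[R]_n).
Local Notation mu := (@lebesgue_measure R).
Local Notation a := (z 0 i - r).

(** With this, [s *: e i + reset u] is [u] with its coordinate [i] replaced by [s]. *)
Definition reset u : 'rV[R]_n := u - u 0 i *: e i.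

(* Starting on the face of the box keeps the interval of integration nonempty. *)
Definition parametric_integral f u : R :=
  \int[mu]_(s in `[a, u 0 i]) f (s *: e i + reset u).

Lemma resetE u : u 0 i *: e i + reset u = u.
Proof. by rewrite /reset addrCA subrr addr0. Qed.

Lemma reset_add_same (t : R) u : reset (t *: e i + u) = reset u.
Proof.
apply/rowP => j; by rewrite !mxE !eqxx /= mulr1 mulrDl opprD addrACA subrr add0r.
Qed.

Lemma reset_add_other (t : R) j u : j != i -> reset (t *: e j + u) = t *: e j + reset u.
Proof.
move=> ji; apply/rowP => k; rewrite !mxE !eqxx /= [i == j]eq_sym.
by rewrite (negbTE ji) mulr0 add0r addrA.
Qed.

Lemma box_coord u : box z r u -> a < u 0 i < z 0 i + r.
Proof. by move=> /(_ i); rewrite ltr_distlC. Qed.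

Lemma line_in_box u (s : R) : box z r u -> a <= s <= z 0 i + r ->
  closed_box z r (s *: e i + reset u).
Proof.
move=> zu sr j; rewrite !mxE !eqxx /=; have [->|ji] := eqVneq j i.
  by rewrite !mulr1 subrr addr0 ler_distlC.
by rewrite !mulr0 add0r subr0; apply/ltW/zu.
Qed.

Lemma line_continuous f u (s : R) : smooth U f -> box z r u ->
  a <= s <= z 0 i + r ->
  {for s, continuous (fun s : R => f (s *: e i + reset u))}.
Proof.
move=> sf zu sr.
apply: (@is_derive_continuous_line _ _ f _ _ s (partial i f (s *: e i + reset u))).
apply: derivableP; apply: smooth_derivable sf _.
exact/sub_boxU/line_in_box.
Qed.

Lemma line_integrable f u (c : R) : smooth U f -> box z r u -> c <= z 0 i + r ->
  mu.-integrable `[a, c] (EFin \o (fun s => f (s *: e i + reset u))).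
Proof.
move=> sf zu cr; apply: continuous_compact_integrable; first exact: segment_compact.
apply: continuous_in_subspaceT => s; rewrite inE /= in_itv /= => /andP[sa sc].
by apply: line_continuous => //; rewrite sa (le_trans sc).
Qed.

Lemma parametric_integral_bound f (M : R) u :
  smooth U f -> 0 <= M -> (forall v, closed_box z r v -> `|f v| <= M) -> box z r u ->
  `|parametric_integral f u| <= M * (r + r).
Proof.
move=> sf M0 fM zu.
have /andP[au ur] := box_coord zu.
have fi := line_integrable sf zu (ltW ur).
apply: le_trans (le_normr_Rintegral _ fi) _ => //.
have nfi : mu.-integrable `[a, u 0 i]
    (EFin \o (fun s => `|f (s *: e i + reset u)|)).
  exact: (integrable_norm fi).
have Mi : mu.-integrable `[a, u 0 i] (EFin \o (fun=> M)).
  apply: continuous_compact_integrable; first exact: segment_compact.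
  by apply: continuous_subspaceT => s; exact: cst_continuous.
have h : \int[mu]_(s in `[a, u 0 i]) `|f (s *: e i + reset u)| <=
    \int[mu]_(s in `[a, u 0 i]) M.
  apply: (le_Rintegral _ nfi Mi) => // s; rewrite /= in_itv /= => /andP[s1 s2].
  by apply: fM; apply: line_in_box; rewrite // s1 (le_trans s2) // ltW.
apply: le_trans h _; rewrite Rintegral_cst //; apply: ler_wpM2l => //.
have muE : mu `[a, u 0 i] = (u 0 i - a)%:E.
  by rewrite lebesgue_measure_itv /= lte_fin au EFinB.
have -> : fine (mu `[a, u 0 i]) = u 0 i - a by rewrite muE.
lra.
Qed.

(** Moving along [e i] fixes [reset u] and changes only the upper limit, so this is the fundamental
    theorem of calculus. *)
Lemma parametric_integral_same f u : smooth U f -> box z r u ->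
  is_derive u (e i) (parametric_integral f) (f u).
Proof.
move=> sf zu; apply/is_derive_line0.
pose g (s : R) := f (s *: e i + reset u).
pose P (y : R) := \int[mu]_(s in `[a, y]) g s.
have E t : parametric_integral f (t *: e i + u) = P (t *: (1 : R) + u 0 i).
  by rewrite /parametric_integral reset_add_same /P !mxE !eqxx.
have -> : (fun t => parametric_integral f (t *: e i + u)) =
    (fun t : R => P (t *: (1 : R) + u 0 i)) by exact/funext.
apply: (is_derive_line0 P (u 0 i) (1 : R) (f u)).1.
have /andP[au ur] := box_coord zu.
(* Integrability up to the opposite face leaves room to the right of the upper limit [u 0 i]. *)
have gi := line_integrable sf zu (lexx (z 0 i + r)).
have cg : {for u 0 i, continuous g}.
  by apply: line_continuous => //; rewrite !ltW.
have [dP EP] := continuous_FTC1_closed ur gi au cg.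
split; first exact: dP.
by rewrite -derive1E EP /g resetE.
Qed.

(** Moving along [e j] fixes the limits of integration. Differentiation under the integral sign
    applies, the dominating function being a constant bound of [partial j f] on the compact box. *)
Lemma parametric_integral_other f j u : smooth U f -> box z r u -> j != i ->
  is_derive u (e j) (parametric_integral f) (parametric_integral (partial j f) u).
Proof.
move=> sf zu ji; apply/is_derive_line0.
have /andP[au ur] := box_coord zu.
pose g (t s : R) := f (t *: e j + (s *: e i + reset u)).
have gE t s : g t s = f (s *: e i + reset (t *: e j + u)).
  by rewrite /g reset_add_other // addrCA.
have [d d0 dP] : exists2 d : R, 0 < d &
    forall t, t \in `]-d, d[ -> box z r (t *: e j + u).
  have oB : \forall y \near u, box z r y.
    exact: (near_open (open_box r_gt0) zu (fun y h => h)).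
  have /nbhs_ballP[d /= d0 dP] := oB.
  have ej0 : 0 < `|e j| + 1 by rewrite ltr_wpDl.
  exists (d / (`|e j| + 1)); first by rewrite divr_gt0.
  move=> t; rewrite in_itv /= -ltr_norml => td; apply: dP.
  rewrite -ball_normE /ball_ /= [_ + u]addrC opprD addNKr normrN normrZ.
  rewrite ltr_pdivlMr // mulrDr mulr1 in td.
  by apply: le_lt_trans td; rewrite lerDl.
have uj t : (t *: e j + u) 0 i = u 0 i.
  by rewrite !mxE eqxx [i == j]eq_sym (negbTE ji) mulr0 add0r.
have E t : parametric_integral f (t *: e j + u) = \int[mu]_(s in `[a, u 0 i]) g t s.
  rewrite /parametric_integral uj; apply: eq_Rintegral => s _.
  by rewrite gE.
have -> : (fun t => parametric_integral f (t *: e j + u)) =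
    (fun t : R => \int[mu]_(s in `[a, u 0 i]) g t s) by exact/funext.
have [M M0 fM] : exists2 M, 0 <= M &
    forall v, closed_box z r v -> `|partial j f v| <= M.
  apply: closed_box_bounded => v; rewrite inE => zv.
  by apply: smooth_continuous (smooth_partial j sf) _; exact: sub_boxU.
have dg (t s : R) : t \in `]-d, d[ -> s \in `[a, u 0 i] ->
    closed_box z r (t *: e j + (s *: e i + reset u)) /\
    is_derive t 1 (g ^~ s) (partial j f (t *: e j + (s *: e i + reset u))).
  move=> td; rewrite in_itv /= => /andP[as_ su].
  have inb : closed_box z r (t *: e j + (s *: e i + reset u)).
    rewrite addrCA -reset_add_other //; apply: line_in_box (dP _ td) _.
    by rewrite as_ (le_trans su) // ltW.
  split=> //; apply: (is_derive_line _ _ _ _ _).1; apply: derivableP.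
  by apply: smooth_derivable sf _; exact: sub_boxU.
have d00 : (0 : R) \in `]-d, d[ by rewrite in_itv /= oppr_lt0 d0.
have intg t : `]-d, d[%classic t -> mu.-integrable `[a, u 0 i] (EFin \o g t).
  move=> td; have := line_integrable (c := u 0 i) sf (dP t td) (ltW ur).
  by congr (mu.-integrable _ _); apply/funext => s /=; rewrite gE.
have derg t s : `]-d, d[%classic t -> `[a, u 0 i]%classic s -> derivable (g ^~ s) t 1.
  by move=> td sa; have [_ []] := dg t s td sa.
have intM : mu.-integrable `[a, u 0 i] (EFin \o (fun=> M)).
  apply: continuous_compact_integrable; first exact: segment_compact.
  by apply: continuous_subspaceT => s; exact: cst_continuous.
have boundg t s : `]-d, d[%classic t -> `[a, u 0 i]%classic s ->
    `|partial1of2 g t s| <= M.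
  move=> td sa; have [inb [_ dv]] := dg t s td sa.
  by rewrite partial1of2E dv; exact: fM.
split.
  exact: (derivable_under_integral _ d00 intg derg (fun=> M0) intM boundg).
have D := @differentiation_under_integral R _ _ mu g `[a, u 0 i]
  (measurable_itv `[a, u 0 i]) 0 (- d) d d00 intg derg (fun=> M) (fun=> M0) intM boundg.
have E1 := derive1E (fun t : R => \int[mu]_(s in `[a, u 0 i]) g t s) 0.
refine (etrans (esym E1) (etrans D _)).
apply: eq_Rintegral => s; rewrite inE => sa.
have [inb [_ dv]] := dg 0 s d00 sa.
by rewrite partial1of2E dv scale0r add0r.
Qed.

Lemma derivable_parametric_integral f j u : smooth U f -> box z r u ->
  derivable (parametric_integral f) u (e j).
Proof.
move=> sf zu; have [->|ji] := eqVneq j i.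
  by have [] := parametric_integral_same sf zu.
by have [] := parametric_integral_other sf zu ji.
Qed.

(** The partial derivatives are [f] itself and the integrals of the [partial j f]; all are bounded
    on the box, so [bounded_partials_continuous] applies. *)
Lemma parametric_integral_continuous f u : smooth U f -> box z r u ->
  {for u, continuous (parametric_integral f)}.
Proof.
move=> sf; have bound g : smooth U g ->
    exists M, 0 <= M /\ forall v, closed_box z r v -> `|g v| <= M.
  move=> sg; have [v|M M0 gM] := @closed_box_bounded R n z r g; last by exists M.
  by rewrite inE => /sub_boxU Uv; exact: smooth_continuous sg Uv.
have [M0 [M00 fM0]] := bound f sf.
have /choice[M HM] := fun j => bound _ (smooth_partial j sf).
have r2 : 0 <= r + r by rewrite addr_ge0 // ltW.
have Mr j : 0 <= M j * (r + r) by rewrite mulr_ge0 //; have [] := HM j.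
(* One bound for all partial derivatives: [M0] serves direction [i], and [M j * (r + r)] serves a
   direction [j != i]. *)
pose S := M0 + \sum_j M j * (r + r).
have S0 : 0 <= S by rewrite addr_ge0 // sumr_ge0.
apply: (@bounded_partials_continuous R n z r _ S r_gt0 S0) => v j zv; split.
  exact: derivable_parametric_integral.
have [->|ji] := eqVneq j i.
  have [_] := parametric_integral_same sf zv; rewrite /partial => ->.
  apply: le_trans (fM0 _ (sub_box_closed zv)) _.
  by rewrite /S lerDl sumr_ge0.
have [_] := parametric_integral_other sf zv ji; rewrite /partial => ->.
have [Mj0 fMj] := HM j.
apply: le_trans (parametric_integral_bound (smooth_partial j sf) Mj0 fMj zv) _.
by rewrite /S (bigD1 j) //= addrCA lerDl addr_ge0 // sumr_ge0.
Qed.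

(** Induction on the order with [f] varying: a partial derivative of the integral is either [f] or
    the integral of [partial j f], which is again smooth. *)
Lemma smooth_parametric_integral f : smooth U f ->
  smooth (box z r) (parametric_integral f).
Proof.
move=> sf k; have ob := @open_box R n z r r_gt0.
have bU : box z r `<=` U by move=> u /sub_box_closed; exact: sub_boxU.
elim: k f sf => [|k IH] f sf; split=> //;
  try by move=> u zu; exact: parametric_integral_continuous.
move=> j; split; first by move=> u zu; exact: derivable_parametric_integral.
have [ji|ji] := eqVneq j i.
  apply: (@eq_Ck _ _ _ _ f) => //; last exact: (sub_smooth bU sf).
  by move=> u zu; rewrite ji; have [_ <-] := parametric_integral_same sf zu.
apply: (@eq_Ck _ _ _ _ (parametric_integral (partial j f))) => //.
  by move=> u zu; have [_ <-] := parametric_integral_other sf zu ji.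
by apply: IH; exact: smooth_partial.
Qed.

End ParametricIntegral.

(** The last clause says that the antiderivative inherits independence of another coordinate from
    [f]. It is what keeps the potentials built later functions of u^2 alone. *)
Lemma smooth_antiderivative (R : realType) (n : nat) (i : 'I_n)
    (U : set 'rV[R]_n) (f : 'rV[R]_n -> R) (z : 'rV[R]_n) :
  open U -> U z -> smooth U f ->
  exists V : set 'rV[R]_n, [/\ open V, V z, V `<=` U & exists F, [/\ smooth V F,
    forall u, V u -> partial i F u = f u &
    forall j, j != i -> (forall u, U u -> partial j f u = 0) ->
      forall u, V u -> partial j F u = 0]].
Proof.
move=> oU Uz sf.
have /nbhs_ballP[d /= d0 dU] := near_open oU Uz (fun y (h : U y) => h).
(* Half the radius, so that the closed box still lies in [U]. *)
have r0 : 0 < d / 2 by rewrite divr_gt0.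
have cU : closed_box z (d / 2) `<=` U.
  move=> u zu; apply: dU; rewrite -box_ballE // => j.
  by apply: le_lt_trans (zu j) _; rewrite ltr_pdivrMr // ltr_pMr // ltr1n.
exists (box z (d / 2)); split.
- exact: open_box.
- exact: box_center.
- by move=> u /sub_box_closed; exact: cU.
exists (parametric_integral i z (d / 2) f); split.
- exact: (smooth_parametric_integral i r0 cU sf).
- by move=> u zu; have [_ <-] := parametric_integral_same i cU sf zu.
move=> j ji fj u zu; have [_] := parametric_integral_other r0 cU sf zu ji.
rewrite /partial => ->; rewrite /parametric_integral.
have := box_coord i zu => /andP[au ur].
transitivity (\int[lebesgue_measure]_(s in `[z 0 i - d / 2, u 0 i]) (0 : R)).
  apply: eq_Rintegral => s; rewrite inE /= in_itv /= => /andP[s1 s2].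
  by apply: fj; apply: cU; apply: line_in_box; rewrite // s1 (le_trans s2) // ltW.
by rewrite Rintegral_cst // mul0r.
Qed.

(** * Linear degeneracy and differential constraints *)

Lemma ord2P (P : 'I_2 -> Prop) : P 0 -> P 1 -> forall i, P i.
Proof.
move=> P0 P1 [[|[|//]] ilt].
  by have -> : Ordinal ilt = 0 by exact: val_inj.
by have -> : Ordinal ilt = 1 by exact: val_inj.
Qed.

Lemma sum_ord2 (V : nmodType) (F : 'I_2 -> V) : \sum_i F i = F 0 + F 1.
Proof.
rewrite !big_ord_recl big_ord0 addr0; congr (F _ + F _); exact: val_inj.
Qed.

Lemma mulmx2E (S : pzSemiRingType) (A B : 'M[S]_2) i j :
  (A *m B) i j = A i 0 * B 0 j + A i 1 * B 1 j.
Proof. by rewrite mxE sum_ord2. Qed.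

Lemma det_mx2 (S : comPzRingType) (A : 'M[S]_2) :
  \det A = A 0 0 * A 1 1 - A 0 1 * A 1 0.
Proof.
rewrite (expand_det_row _ 0) sum_ord2 /cofactor !det_mx11 !mxE /=.
have -> : lift 0 0 = 1 :> 'I_2 by exact: val_inj.
have -> : lift 1 0 = 0 :> 'I_2 by exact: val_inj.
by rewrite expr0 expr1 mul1r mulN1r mulrN.
Qed.

Section JordanSystem.
Variables (R : realType) (U : set 'rV[R]_2) (lam mu : 'rV[R]_2 -> R).
Hypothesis lam_smooth : smooth U lam.
Hypothesis mu_neq0 : forall u, U u -> mu u != 0.

Lemma jordan_mxE u : ((jordan_mx lam mu u 0 0 = lam u) *
  (jordan_mx lam mu u 0 1 = mu u) * (jordan_mx lam mu u 1 0 = 0) *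
  (jordan_mx lam mu u 1 1 = lam u))%type.
Proof.
rewrite /jordan_mx; do ![split]; rewrite !mxE /=;
  by rewrite ?mulr0 ?mulr1 ?addr0 ?add0r.
Qed.

(** Here f_1 = -2 lambda and f_2 = lambda^2. The first entry of the row vector vanishes identically;
    in the second the terms with lambda_2 cancel and -2 mu lambda_1 remains. *)
Lemma linearly_degenerateP : linearly_degenerate U (jordan_mx lam mu) <->
  forall u, U u -> partial 0 lam u = 0.
Proof.
have f1E : (fun u => (char_poly (jordan_mx lam mu u))`_1) = fun u => -2 * lam u.
  apply/funext => u; rewrite (char_poly_trace (n := 2)) // /mxtrace sum_ord2.
  by rewrite !jordan_mxE; ring.
have f2E : (fun u => (char_poly (jordan_mx lam mu u))`_0) = fun u => lam u * lam u.
  apply/funext => u; rewrite char_poly_det det_mx2 !jordan_mxE; ring.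
rewrite /linearly_degenerate f1E f2E.
have dl u i : U u -> derivable lam u (delta_mx 0 i : 'rV[R]_2).
  by move=> Uu; exact: smooth_derivable lam_smooth Uu.
have df1 u i : U u -> partial i (fun u => -2 * lam u) u = -2 * partial i lam u.
  move=> Uu; have dc : derivable (fun=> -2 : R) u (delta_mx 0 i : 'rV[R]_2).
    exact: derivable_cst.
  by rewrite (partialM dc (dl u i Uu)) partial_cst mul0r addr0.
have df2 u i : U u -> partial i (fun u => lam u * lam u) u =
    2 * lam u * partial i lam u.
  by move=> Uu; rewrite partialM; [ring|exact: dl|exact: dl].
have E (f1 f2 : 'rV[R]_2 -> R) u (A : 'M[R]_2) j :
    (gradient f1 u *m A + gradient f2 u) 0 j =
    partial 0 f1 u * A 0 j + partial 1 f1 u * A 1 j + partial j f2 u.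
  by rewrite !mxE sum_ord2 !mxE.
split=> [ld u Uu|l0 u Uu].
  have /rowP/(_ 1) := ld u Uu; rewrite E [RHS]mxE !df1 // df2 // !jordan_mxE => H.
  apply: (mulIf (mu_neq0 Uu)); apply: (@mulfI _ (-2)).
    by rewrite oppr_eq0 pnatr_eq0.
  by rewrite mul0r mulr0 -H; ring.
by apply/rowP; apply: ord2P; rewrite E [RHS]mxE !df1 // df2 // !jordan_mxE l0 //; ring.
Qed.

End JordanSystem.

(** * Functions of u regarded as functions of (t, x, u) *)

Section RightBlock.
Variables (R : realType) (m n : nat).
Implicit Types (f : 'rV[R]_n -> R) (z : 'rV[R]_(m + n)).

Local Notation e k i := (delta_mx 0 i : 'rV[R]_k).

Lemma is_derive_rsubmx_lshift f (i : 'I_m) z :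
  is_derive z (e (m + n) (lshift n i)) (fun y => f (rsubmx y)) 0.
Proof.
apply: (is_derive_line0 (fun y : 'rV[R]_(m + n) => f (rsubmx y)) _ _ _).2.
have -> : (fun t : R => f (rsubmx (t *: e (m + n) (lshift n i) + z))) =
    cst (f (rsubmx z)).
  apply/funext => t; congr f; apply/rowP => j; rewrite !mxE.
  by rewrite eqxx /= eq_rlshift mulr0 add0r.
exact: is_derive_cst.
Qed.

Lemma derive_rsubmx_rshift f (i : 'I_n) z :
  (derivable (fun y => f (rsubmx y)) z (e (m + n) (rshift m i)) =
   derivable f (rsubmx z) (e n i)) *
  (partial (rshift m i) (fun y => f (rsubmx y)) z = partial i f (rsubmx z)).
Proof.
have E : (fun h : R => h^-1 *: (((fun y => f (rsubmx y)) \o shift z)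
      (h *: e (m + n) (rshift m i)) - f (rsubmx z))) =
    (fun h => h^-1 *: ((f \o shift (rsubmx z)) (h *: e n i) - f (rsubmx z))).
  apply/funext => h /=; congr (_ *: (f _ - _)); apply/rowP => j.
  by rewrite !mxE !eqxx /= (inj_eq (@rshift_inj _ _)).
by split; rewrite /derivable /partial /derive E.
Qed.

Lemma continuous_at_rsubmx f z : {for rsubmx z, continuous f} ->
  {for z, continuous (fun y => f (rsubmx y))}.
Proof.
move=> cf; have cr := @continuous_rsubmx R 1 m n z.
exact: (@continuous_comp 'rV[R]_(m + n) 'rV[R]_n R rsubmx f z cr cf).
Qed.

Lemma open_rsubmx (U : set 'rV[R]_n) : open U ->
  open [set z : 'rV[R]_(m + n) | U (rsubmx z)].
Proof.
move=> oU; have cr z := @continuous_rsubmx R 1 m n z.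
exact: (@open_comp 'rV[R]_(m + n) 'rV[R]_n rsubmx U (fun z _ => cr z) oU).
Qed.

Lemma smooth_rsubmx (U : set 'rV[R]_n) f : smooth U f ->
  smooth [set z : 'rV[R]_(m + n) | U (rsubmx z)] (fun z => f (rsubmx z)).
Proof.
move=> sf k; elim: k f sf => [|k IH] f sf; split=> //;
  try by move=> z Uz; apply: continuous_at_rsubmx; exact: smooth_continuous sf Uz.
move=> i; case: (split_ordP i) => j ->.
  have dj z := is_derive_rsubmx_lshift f j z; split.
    by move=> z _; have [] := dj z.
  have -> : partial (lshift n j) (fun y => f (rsubmx y)) = cst 0.
    by apply/funext => z; have [] := dj z.
  exact: Ck_cst.
split.
  move=> z Uz; rewrite derive_rsubmx_rshift; exact: smooth_derivable sf Uz.
have -> : partial (rshift m j) (fun y => f (rsubmx y)) =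
    (fun y => partial j f (rsubmx y)).
  by apply/funext => z; rewrite derive_rsubmx_rshift.
by apply: IH; exact: smooth_partial.
Qed.

End RightBlock.

(** * Quasilinear differential constraints *)

Section Constraint.
Variables (R : realType) (U : set 'rV[R]_2) (lam mu : 'rV[R]_2 -> R).
Hypotheses (U_open : open U) (lam_smooth : smooth U lam).

Local Notation U4 := [set z : 'rV[R]_(2 + 2) | U (rsubmx z)].

(** Compatibility forces lambda_1 phi = 0. If lambda_1 were nonzero at [u], it would be so nearby by
    continuity, and phi would vanish near [z0], against nontriviality. *)
Lemma quasilinear_constraint_partial0 u :
  admits_quasilinear_constraint U lam mu -> U u -> partial 0 lam u = 0.
Proof.
move=> ac Uu; pose z0 : 'rV[R]_(2 + 2) := row_mx 0 u.
have z0u : rsubmx z0 = u by rewrite /z0 row_mxKr.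
have [|W [oW Wz0 WU [phi [sphi nphi cphi]]]] := ac z0; first by rewrite z0u.
have lphi z : W z -> partial 0 lam (rsubmx z) * phi z = 0.
  move=> Wz; have Uz := WU z Wz.
  (* The condition is affine in [p]; the difference of its instances at 1 and 0 isolates the
     coefficient of [p]. *)
  have := cphi z 1 Wz; have := cphi z 0 Wz.
  have -> : partial u1_ (fun z => lam (rsubmx z) * phi z) z =
      lam (rsubmx z) * partial u1_ phi z + partial 0 lam (rsubmx z) * phi z.
    rewrite partialM; first by rewrite derive_rsubmx_rshift.
      rewrite derive_rsubmx_rshift; exact: smooth_derivable lam_smooth Uz.
    exact: smooth_derivable sphi Wz.
  set a := partial t_ _ _; set b := partial u1_ _ _; set c := partial u2_ _ _.
  set d := partial x_ _ _; set k := partial u2_ _ _; set l0 := partial 0 _ _.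
  by move=> E0 E1; lra.
apply/eqP/negP => /negP l0.
have cl : {for z0, continuous (fun z => partial 0 lam (rsubmx z))}.
  apply: continuous_at_rsubmx; rewrite z0u.
  exact: smooth_continuous (smooth_partial 0 lam_smooth) Uu.
have l0z0 : partial 0 lam (rsubmx z0) != 0 by rewrite z0u.
have nl := @cvgr_neq0 _ _ _ _ (nbhs_filter z0) _ _ cl l0z0.
have nW := near_open oW Wz0 lphi.
apply: nphi; apply: (@filterS2 _ _ (nbhs_filter z0) _ _ _ _ nl nW) => z lz /eqP.
by rewrite mulf_eq0 (negbTE lz) => /eqP.
Qed.

(** For phi = 1 / D with D = 1 - lambda_2 (t - t0), both phi_x and phi_1 vanish, the terms lambda
    phi phi_2 cancel, and phi_t = lambda_2 phi^2 is what remains of the condition. *)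
Lemma quasilinear_constraint_exists :
  (forall u, U u -> partial 0 lam u = 0) -> admits_quasilinear_constraint U lam mu.
Proof.
move=> l0 z0 Uz0; pose c := - z0 0 t_; pose l1 := partial 1 lam.
pose L (z : 'rV[R]_(2 + 2)) := l1 (rsubmx z).
pose D z := 1 + - L z * (z 0 t_ + c).
have oU4 : open U4 by exact: open_rsubmx.
have sL : smooth U4 L.
  exact: (@smooth_rsubmx R 2 2 U _ (smooth_partial 1 lam_smooth)).
have sl : smooth U4 (fun z => lam (rsubmx z)).
  exact: (@smooth_rsubmx R 2 2 U _ lam_smooth).
have st : smooth U4 (fun z => z 0 t_ + c).
  by apply: smoothD => //; [exact: smooth_coord|exact: smooth_cst].
have sLt : smooth U4 (fun z => - L z * (z 0 t_ + c)).
  by apply: smoothM => //; exact: smoothN.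
have sD : smooth U4 D by apply: smoothD => //; exact: smooth_cst.
(* The domain stops short of the blow-up; it contains [z0] because the choice of [c] gives
   [D z0 = 1]. *)
pose W := [set z | U4 z /\ D z != 0].
have WU : W `<=` U4 by move=> z [].
have oW : open W.
  rewrite openE => z [Uz Dz].
  apply: (@filterS2 _ _ (nbhs_filter z) U4 (fun z => D z != 0)).
  - by move=> y; split.
  - exact: open_nbhs_nbhs.
  - exact: (@cvgr_neq0 _ _ _ _ (nbhs_filter z) _ _ (smooth_continuous sD Uz) Dz).
have Dz0 : D z0 = 1 by rewrite /D /c subrr mulr0 addr0.
have Wz0 : W z0 by split=> //; rewrite Dz0 oner_eq0.
exists W; split=> //.
pose phi z := (D z)^-1.
have sphi : smooth W phi.
  by apply: smoothV => //; [move=> z []|exact: sub_smooth WU sD].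
exists phi; split=> //.
  move/nbhs_singleton => /eqP; rewrite /phi Dz0 invr1 oner_eq0; exact.
move=> z p Wz; have [Uz Dz] := Wz.
have dD i : partial i D z = - L z * (i == t_)%:R - partial i L z * (z 0 t_ + c).
  have dL := smooth_derivable (i := i) sL Uz.
  have dt := smooth_derivable (i := i) st Uz.
  have dNL := smooth_derivable (i := i) (smoothN oU4 sL) Uz.
  have d1 := smooth_derivable (i := i) (@smooth_cst _ _ U4 (1 : R)) Uz.
  rewrite (partialD d1 (smooth_derivable (i := i) sLt Uz)) partial_cst add0r.
  rewrite (partialM dNL dt).
  have -> : partial i (fun z => - L z) z = - partial i L z.
    by rewrite /partial; exact: (deriveN dL).
  have [dc vc] := is_derive_coord t_ i z.
  have -> : partial i (fun z : 'rV[R]_(2 + 2) => z 0 t_ + c) z = (i == t_)%:R.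
    by rewrite (partialD dc (derivable_cst _ _ _)) partial_cst addr0.
  by rewrite !mulNr.
have dphi i : partial i phi z = phi z * phi z *
    (L z * (i == t_)%:R + partial i L z * (z 0 t_ + c)).
  rewrite partialV ?dD //; last exact: smooth_derivable sD Uz.
  by rewrite /phi expr2 invfM; ring.
have dlphi i : partial i (fun z => lam (rsubmx z) * phi z) z =
    lam (rsubmx z) * partial i phi z + partial i (fun z => lam (rsubmx z)) z * phi z.
  rewrite partialM //; first exact: smooth_derivable sl Uz.
  exact: smooth_derivable sphi Wz.
(* By symmetry of second derivatives, lambda_2 does not depend on u^1 either. *)
have L1 : partial u1_ L z = 0.
  rewrite derive_rsubmx_rshift /l1 (partialC _ _ U_open lam_smooth Uz).
  by rewrite (eq_partial (g := fun=> 0) _ U_open l0 Uz) partial_cst.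
have Lx : partial x_ L z = 0 by have [_] := is_derive_rsubmx_lshift l1 1 z.
have Lt : partial t_ L z = 0 by have [_] := is_derive_rsubmx_lshift l1 0 z.
have lx : partial x_ (fun z => lam (rsubmx z)) z = 0.
  by have [_] := is_derive_rsubmx_lshift lam 1 z.
have l1z : partial u1_ (fun z => lam (rsubmx z)) z = 0.
  by rewrite derive_rsubmx_rshift l0.
have l2z : partial u2_ (fun z => lam (rsubmx z)) z = L z.
  by rewrite derive_rsubmx_rshift.
rewrite !dlphi lx l1z l2z !dphi L1 Lx Lt.
have -> : (x_ == t_) = false by [].
have -> : (u1_ == t_) = false by [].
have -> : (u2_ == t_) = false by [].
rewrite eqxx /=; ring.
Qed.

End Constraint.

(** * Dubrovin-Novikov operators *)

Section Geometry.
Variables (R : realType) (n : nat).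
Implicit Types (V : set 'rV[R]_n) (G g : 'rV[R]_n -> 'M[R]_n) (h : 'rV[R]_n -> R).

Lemma smooth_det V (m : nat) (M : 'rV[R]_n -> 'M[R]_m) : open V ->
  (forall i j, smooth V (fun u => M u i j)) -> smooth V (fun u => \det (M u)).
Proof.
move=> oV sM; apply: smooth_sum => // s; apply: smoothM => //.
  exact: smooth_cst.
exact: smooth_prod.
Qed.

Lemma smooth_invmx V g : open V -> (forall i j, smooth V (fun u => g u i j)) ->
  (forall u, V u -> \det (g u) != 0) ->
  forall i j, smooth V (fun u => invmx (g u) i j).
Proof.
move=> oV sg dg i j.
(* Cramer's formula: cofactors divided by the determinant. *)
apply: (eq_smooth (f := fun u => (\det (g u))^-1 *
   ((-1) ^+ (j + i) * \det (row' j (col' i (g u)))))) => //.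
  by move=> u /dg gu; rewrite /invmx unitmxE unitfE gu !mxE.
apply: smoothM => //; first by apply: smoothV => //; exact: smooth_det.
apply: smoothM => //; first exact: smooth_cst.
apply: smooth_det => // k l.
by apply: eq_smooth (sg (lift j k) (lift i l)) => // u _; rewrite !mxE.
Qed.

Lemma smooth_christoffel V G (j s k : 'I_n) : open V ->
  (forall i l, smooth V (fun u => G u i l)) ->
  (forall i l, smooth V (fun u => invmx (G u) i l)) ->
  smooth V (christoffel G j s k).
Proof.
move=> oV sG sg; apply: smoothM => //; first exact: smooth_cst.
apply: smooth_sum => // l; apply: smoothM => //.
by do 2?[apply: smoothD => //; try apply: smoothN => //]; exact: smooth_partial.
Qed.

Lemma christoffelC V G (j s k : 'I_n) u : open V ->
  (forall u, V u -> (G u)^T = G u) -> V u ->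
  christoffel G j s k u = christoffel G j k s u.
Proof.
move=> oV symG Vu; rewrite /christoffel; congr (_ * _); apply: eq_bigr => l _.
congr (_ * (_ - _)); first exact: addrC.
by apply: (eq_partial _ oV) => // v Vv; rewrite -[in LHS](symG v Vv) mxE.
Qed.

Definition covariant_hessian G h (u : 'rV[R]_n) : 'M[R]_n :=
  \matrix_(s, k) (partial k (partial s h) u
                  - \sum_j christoffel G j s k u * partial j h u).

Lemma covariant_hessianC V G h u : open V -> (forall u, V u -> (G u)^T = G u) ->
  smooth V h -> V u -> (covariant_hessian G h u)^T = covariant_hessian G h u.
Proof.
move=> oV symG sh Vu; apply/matrixP => s k; rewrite !mxE.
rewrite (partialC _ _ oV sh Vu); congr (_ - _); apply: eq_bigr => j _.
by rewrite (christoffelC _ _ _ oV symG Vu).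
Qed.

(** Inserting b = -g Gamma merges the first-order terms with the second derivatives of [h] into its
    second covariant derivatives. *)
Lemma dn_flowE g (b : 'rV[R]_n -> 'I_n -> 'I_n -> 'I_n -> R) h i u p :
  (forall i j k, b u i j k =
     - \sum_s g u i s * christoffel (fun v => invmx (g v)) j s k u) ->
  dn_flow g b h i u p =
  \sum_k (g u *m covariant_hessian (fun v => invmx (g v)) h u) i k * p 0 k.
Proof.
move=> bE; rewrite /dn_flow.
have E k : (g u *m covariant_hessian (fun v => invmx (g v)) h u) i k =
    \sum_j (g u i j * partial k (partial j h) u + b u i j k * partial j h u).
  rewrite mxE big_split /=.
  under eq_bigr do rewrite mxE mulrBr.
  rewrite big_split /=; congr (_ + _).
  rewrite sumrN; under [RHS]eq_bigr do rewrite bE mulNr mulr_suml.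
  rewrite sumrN exchange_big /=; congr (- _); apply: eq_bigr => s _.
  by rewrite mulr_sumr; apply: eq_bigr => j _; rewrite mulrA.
under [RHS]eq_bigr do rewrite E mulr_suml.
rewrite exchange_big /=; apply: eq_bigr => j _.
rewrite mulr_sumr mulr_suml -big_split /=; apply: eq_bigr => k _; ring.
Qed.

(** Both sides are linear in [p], so evaluation at the basis vectors reads off the matrix
    columns. *)
Lemma dn_flowP g (b : 'rV[R]_n -> 'I_n -> 'I_n -> 'I_n -> R) h (A : 'M[R]_n) u :
  (forall i j k, b u i j k =
     - \sum_s g u i s * christoffel (fun v => invmx (g v)) j s k u) ->
  (forall (p : 'rV[R]_n) i, \sum_j A i j * p 0 j = dn_flow g b h i u p) <->
  A = g u *m covariant_hessian (fun v => invmx (g v)) h u.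
Proof.
move=> bE; split=> [Aflow|-> p i]; last by rewrite dn_flowE.
apply/matrixP => i k; have := Aflow (delta_mx 0 k) i; rewrite dn_flowE //.
have E (M : 'M[R]_n) : \sum_j M i j * (delta_mx 0 k : 'rV[R]_n) 0 j = M i k.
  rewrite (bigD1 k) //= mxE !eqxx mulr1 big1 ?addr0 // => j jk.
  by rewrite mxE (negbTE jk) andbF mulr0.
by rewrite !E.
Qed.

End Geometry.

(** * Hamiltonian systems are linearly degenerate *)

Section Necessity.
Variables (R : realType) (V : set 'rV[R]_2) (lam mu : 'rV[R]_2 -> R).
Hypotheses (V_open : open V) (lam_smooth : smooth V lam).
Hypothesis mu_neq0 : forall u, V u -> mu u != 0.
Variables (g : 'rV[R]_2 -> 'M[R]_2) (b : 'rV[R]_2 -> 'I_2 -> 'I_2 -> 'I_2 -> R).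
Variable h : 'rV[R]_2 -> R.
Hypotheses (hamg : nondegenerate_hamiltonian V g b) (h_smooth : smooth V h).
Hypothesis flow : forall u (p : 'rV[R]_2), V u -> forall i,
  \sum_j jordan_mx lam mu u i j * p 0 j = dn_flow g b h i u p.

Local Notation G := (fun u => invmx (g u)).

Lemma hamiltonian_partial0 u : V u -> partial 0 lam u = 0.
Proof.
have [sg dg symg flatG bE] := hamg.
have ug v : V v -> g v \in unitmx by move=> Vv; rewrite unitmxE unitfE dg.
have sG i j : smooth V (fun v => G v i j) by exact: smooth_invmx.
have symG v : V v -> (G v)^T = G v by move=> Vv; rewrite trmx_inv symg.
have sGamma j s k : smooth V (christoffel G j s k).
  apply: smooth_christoffel => // i l.
  by apply: eq_smooth (sg i l) => // v _; rewrite invmxK.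
pose H := covariant_hessian G h.
have HE v : V v -> H v = G v *m jordan_mx lam mu v.
  move=> Vv; have [/(_ (fun p i => flow p Vv i)) -> _] :=
    @dn_flowP R 2 g b h (jordan_mx lam mu v) v (bE v Vv).
  by rewrite mulmxA mulVmx ?mul1mx // ug.
have HM v i j : V v -> H v i j =
    G v i 0 * jordan_mx lam mu v 0 j + G v i 1 * jordan_mx lam mu v 1 j.
  by move=> Vv; rewrite HE // mulmx2E.
have Gsym v : V v -> G v 1 0 = G v 0 1.
  by move=> Vv; rewrite -[in LHS](symG v Vv) mxE.
(* The off-diagonal entries of the symmetric matrix [H v] are G_11 mu + G_12 lambda and G_12
   lambda. *)
have G00 v : V v -> G v 0 0 = 0.
  move=> Vv; have : H v 0 1 = H v 1 0.
    have := covariant_hessianC V_open symG h_smooth Vv.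
    by move/matrixP/(_ 1 0); rewrite mxE.
  rewrite !HM // !jordan_mxE Gsym // mulr0 addr0 => /(canRL (addrK _)).
  by rewrite subrr => /eqP; rewrite mulf_eq0 (negbTE (mu_neq0 Vv)) orbF => /eqP.
have gG v i j : V v -> g v i 0 * G v 0 j + g v i 1 * G v 1 j = (i == j)%:R.
  by move=> Vv; rewrite -mulmx2E mulmxV ?ug // mxE.
have g01 v : V v -> g v 0 1 * G v 0 1 = 1.
  by move=> Vv; have := gG v 0 0 Vv; rewrite G00 // Gsym // mulr0 add0r.
have G01 v : V v -> G v 0 1 != 0.
  move=> Vv; apply/eqP => z; have := g01 v Vv; rewrite z mulr0.
  by move/eqP; rewrite eq_sym oner_eq0.
have g11 v : V v -> g v 1 1 = 0.
  move=> Vv; have := gG v 1 0 Vv; rewrite G00 // Gsym // mulr0 add0r => /eqP.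
  by rewrite mulf_eq0 (negbTE (G01 v Vv)) orbF => /eqP.
have dG00 v i : V v -> partial i (fun y => G y 0 0) v = 0.
  by move=> Vv; rewrite (eq_partial (g := fun=> 0) _ V_open G00 Vv) partial_cst.
have dG10 v i : V v -> partial i (fun y => G y 1 0) v = partial i (fun y => G y 0 1) v.
  by move=> Vv; exact: (eq_partial _ V_open Gsym Vv).
have chrE j s k v : christoffel G j s k v = 2^-1 *
   (g v j 0 * (partial s (fun y => G y 0 k) v + partial k (fun y => G y 0 s) v
     - partial 0 (fun y => G y s k) v) +
    g v j 1 * (partial s (fun y => G y 1 k) v + partial k (fun y => G y 1 s) v
     - partial 1 (fun y => G y s k) v)).
  by rewrite /christoffel sum_ord2 invmxK.
(* As [g v 1 1 = 0], only the bracket multiplied by [g v 1 0] is left. For this symbol and the next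
   it reduces to derivatives of [G v 0 0], which vanish. *)
have c100 v : V v -> christoffel G 1 0 0 v = 0.
  by move=> Vv; rewrite chrE g11 // !dG00 // mul0r !addr0 subrr !mulr0.
have c101 v : V v -> christoffel G 1 0 1 v = 0.
  move=> Vv; rewrite chrE g11 // !dG00 // mul0r !addr0 subrr !mulr0.
  by [].
pose P := christoffel G 0 0 0; pose Q := christoffel G 0 0 1.
pose k := partial 0 h; pose B v := G v 0 1.
have sk : smooth V k by exact: smooth_partial.
(* The first row of [H v] is (0, B lambda). Since the two symbols above vanish, [partial 1 h] does
   not enter it, and the row is a linear system for [k] alone. *)
have e1 v : V v -> partial 0 k v = P v * k v.
  move=> Vv; have := HM v 0 0 Vv; rewrite mxE sum_ord2 c100 // G00 // !jordan_mxE.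
  by rewrite !mul0r mulr0 !addr0 => /eqP; rewrite subr_eq0 => /eqP.
have e2 v : V v -> partial 1 k v = Q v * k v + B v * lam v.
  move=> Vv; have := HM v 0 1 Vv; rewrite mxE sum_ord2 c101 // G00 // !jordan_mxE.
  by rewrite !mul0r !addr0 add0r => /eqP; rewrite subr_eq addrC => /eqP.
have e3 v : V v -> partial 0 B v = P v * B v.
  move=> Vv; rewrite /P chrE !dG00 // !dG10 // !addr0 subrr mulr0 add0r subr0.
  have := g01 v Vv; rewrite /B.
  set x := g v 0 1; set y := G v 0 1; set d := partial _ _ _.
  move=> xy; have -> : 2^-1 * (x * (d + d)) * y = (x * y) * d by field.
  by rewrite xy mul1r.
(* In this curvature component the quadratic terms with m = 0 cancel by symmetry of the lower
   indices, and those with m = 1 contain a vanishing symbol. *)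
have e4 v : V v -> partial 1 P v = partial 0 Q v.
  move=> Vv; have := flatG v Vv 0 0 1 0; rewrite /riemann sum_ord2.
  have Gamma_sym j y : V y -> christoffel G j 1 0 y = christoffel G j 0 1 y.
    exact: christoffelC.
  move: (c100 v Vv) (c101 v Vv) Gamma_sym; rewrite /P /Q.
  move: (christoffel G) => Gamma g100 g101 Gamma_sym.
  rewrite !(Gamma_sym _ v Vv) g100 g101 !mulr0 subrr addr0.
  rewrite (eq_partial 0 V_open (Gamma_sym 0) Vv) mulrC subrr addr0.
  by move/eqP; rewrite subr_eq0 => /eqP.
move=> Vu; have sB : smooth V B by exact: sG.
have sP : smooth V P by exact: sGamma.
have sQ : smooth V Q by exact: sGamma.
have D f i : smooth V f -> derivable f u (delta_mx 0 i : 'rV[R]_2).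
  by move=> sf; exact: smooth_derivable sf Vu.
(* Equating (Q k + B lambda)_1 with (P k)_2 and using the four relations, every term cancels except
   B lambda_1. *)
have := partialC 0 1 V_open sk Vu.
rewrite (eq_partial _ V_open e2 Vu) (eq_partial _ V_open e1 Vu).
have sQk : smooth V (fun v => Q v * k v) by exact: smoothM.
have sBl : smooth V (fun v => B v * lam v) by exact: smoothM.
rewrite (partialD (D _ 0 sQk) (D _ 0 sBl)) (partialM (D _ 0 sQ) (D _ 0 sk)).
rewrite (partialM (D _ 0 sB) (D _ 0 lam_smooth)) (partialM (D _ 1 sP) (D _ 1 sk)).
rewrite e1 // e2 // e3 // e4 //.
set p := P u; set q := Q u; set w := k u; set l := lam u; set dq := partial 0 Q u.
set dl := partial 0 lam u => E; apply: (mulfI (G01 u Vu)); rewrite mulr0 -/(B u).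
move: E; set bu := B u => E.
have -> : bu * dl = q * (p * w) + dq * w + (bu * dl + p * bu * l)
   - (q * (p * w) + dq * w + p * bu * l) by ring.
rewrite E; ring.
Qed.

End Necessity.

(** * Linearly degenerate systems are Hamiltonian: the potentials y, L and K *)

Lemma jordan_potentials (R : realType) (U : set 'rV[R]_2)
    (lam mu : 'rV[R]_2 -> R) (z : 'rV[R]_2) :
  open U -> smooth U lam -> smooth U mu -> (forall u, U u -> mu u != 0) ->
  (forall u, U u -> partial 0 lam u = 0) -> U z ->
  exists V : set 'rV[R]_2, [/\ open V, V z, V `<=` U &
  exists y L K : 'rV[R]_2 -> R, [/\ smooth V y, smooth V L, smooth V K &
    forall u, V u -> [/\ partial 0 y u != 0, partial 0 L u = 0,
      partial 1 L u = lam u, partial 0 K u = 0 &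
      partial 1 (partial 1 K) u = mu u * partial 0 y u - partial 1 lam u * y u]]].
Proof.
move=> oU sl sm m0 l0 Uz.
have smV : smooth U (fun u => (mu u)^-1) by exact: smoothV.
have [V1 [oV1 V1z V1U [F [sF F0 _]]]] := smooth_antiderivative 0 oU Uz smV.
pose l1 := partial 1 lam; have sl1 : smooth V1 l1.
  by apply: sub_smooth V1U _; exact: smooth_partial.
(* This will be mu y_1. As lambda_2 is independent of u^1 and F_1 = 1 / mu, it satisfies w_1 =
   lambda_2 w / mu = lambda_2 y_1. *)
pose w u := expR (l1 u * F u).
have sl1F : smooth V1 (fun u => l1 u * F u) by exact: smoothM.
have sw : smooth V1 w by exact: smooth_expR.
have swm : smooth V1 (fun u => w u * (mu u)^-1).
  by apply: smoothM => //; exact: sub_smooth V1U smV.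
have [V2 [oV2 V2z V21 [y [sy y0 _]]]] := smooth_antiderivative 0 oV1 V1z swm.
have V2U : V2 `<=` U by move=> u /V21/V1U.
have my0 u : V2 u -> mu u * partial 0 y u = w u.
  by move=> Vu; rewrite y0 // mulrCA mulfV ?mulr1 // m0 //; exact: V2U.
have l10 u : U u -> partial 0 l1 u = 0.
  move=> Uu; rewrite /l1 (partialC _ _ oU sl Uu).
  by rewrite (eq_partial _ oU l0 Uu) partial_cst.
have w0 u : V2 u -> partial 0 w u = l1 u * partial 0 y u.
  move=> Vu; have V1u := V21 u Vu.
  have [_ E] := is_derive_expR_comp (smooth_derivable (i := 0) sl1F V1u).
  have {}E : partial 0 w u = w u * partial 0 (fun v => l1 v * F v) u := E.
  rewrite E (partialM (smooth_derivable sl1 V1u) (smooth_derivable sF V1u)).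
  rewrite l10 ?F0 //; last exact: V1U.
  by rewrite mul0r addr0 y0 // mulrCA.
(* The prescribed value of K''. Its u^1-derivative is w_1 - lambda_2 y_1 = 0, so it can be
   integrated twice in u^2 without acquiring a dependence on u^1. *)
pose k u := mu u * partial 0 y u - l1 u * y u.
have sk : smooth V2 k.
  apply: smoothD => //.
    by apply: smoothM => //; [exact: sub_smooth V2U sm|exact: smooth_partial].
  by apply: smoothN => //; apply: smoothM => //; exact: sub_smooth V21 sl1.
have k0 u : V2 u -> partial 0 k u = 0.
  move=> Vu; have V1u := V21 u Vu.
  have kE v : V2 v -> k v = w v + -1 * (l1 v * y v).
    by move=> Vv; rewrite /k my0 // mulN1r.
  have sly : smooth V2 (fun v => l1 v * y v).
    by apply: smoothM => //; exact: sub_smooth V21 sl1.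
  have sm1 : smooth V2 (fun=> -1 : R) by exact: smooth_cst.
  rewrite (eq_partial _ oV2 kE Vu).
  rewrite (partialD (smooth_derivable sw V1u)); last first.
    by apply: smooth_derivable Vu; exact: smoothM.
  rewrite (partialM (smooth_derivable sm1 Vu) (smooth_derivable sly Vu)) partial_cst.
  rewrite (partialM (smooth_derivable sl1 V1u) (smooth_derivable sy Vu)).
  by rewrite l10 ?w0 //; [ring|exact: V2U].
have [V3 [oV3 V3z V32 [K1 [sK1 K11 K10]]]] := smooth_antiderivative 1 oV2 V2z sk.
have [V4 [oV4 V4z V43 [K [sK K11' K10']]]] := smooth_antiderivative 1 oV3 V3z sK1.
have V4U : V4 `<=` U by move=> u /V43/V32/V2U.
have sl4 : smooth V4 lam := sub_smooth V4U sl.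
have [V5 [oV5 V5z V54 [L [sL L1 L0]]]] := smooth_antiderivative 1 oV4 V4z sl4.
have V5U : V5 `<=` U by move=> u /V54/V4U.
exists V5; split=> //; exists y, L, K; split=> //.
- by apply: sub_smooth sy => u /V54/V43/V32.
- exact: sub_smooth V54 sK.
move=> u V5u; have V4u := V54 u V5u; have V3u := V43 u V4u; have V2u := V32 u V3u.
split.
- rewrite y0 //; apply: mulf_neq0; first by rewrite gt_eqF ?expR_gt0.
  by rewrite invr_eq0 m0 //; exact: V2U.
- by apply: L0 => // v V4v; exact/l0/V4U.
- exact: L1.
- by apply: K10' => // v V3v; apply: K10 => // v' V2v'; exact: k0.
- by rewrite (eq_partial _ oV4 K11' V4u) K11.
Qed.

(** * The flat metric and the Hamiltonian density built from y, L and K *)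

Section Sufficiency.
Variables (R : realType) (V : set 'rV[R]_2) (lam mu y L K : 'rV[R]_2 -> R).
Hypotheses (V_open : open V) (y_smooth : smooth V y) (L_smooth : smooth V L).
Hypothesis K_smooth : smooth V K.
Hypothesis y0_neq0 : forall u, V u -> partial 0 y u != 0.
Hypotheses (L0 : forall u, V u -> partial 0 L u = 0)
  (L1 : forall u, V u -> partial 1 L u = lam u)
  (K0 : forall u, V u -> partial 0 K u = 0)
  (K11 : forall u, V u ->
     partial 1 (partial 1 K) u = mu u * partial 0 y u - partial 1 lam u * y u).
Hypothesis lam0 : forall u, V u -> partial 0 lam u = 0.

(** The components of 2 dy du^2 in the coordinates (u^1, u^2). In the null coordinates (y, u^2) its
    coefficients are constant, whence flatness. *)
Definition null_metric (u : 'rV[R]_2) : 'M[R]_2 :=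
  \matrix_(i, j) if i == 0 then (if j == 0 then 0 else partial 0 y u)
                 else (if j == 0 then partial 0 y u else 2 * partial 1 y u).

Local Notation G := null_metric.
Local Notation d i := (partial i).

Lemma null_metricE u : ((G u 0 0 = 0) * (G u 0 1 = d 0 y u) *
  (G u 1 0 = d 0 y u) * (G u 1 1 = (2 * d 1 y u)%R))%type.
Proof. by do ![split]; rewrite mxE. Qed.

Lemma det_null_metric u : V u -> \det (G u) != 0.
Proof.
move=> Vu; rewrite det_mx2 !null_metricE mul0r sub0r oppr_eq0.
by rewrite mulf_neq0 // y0_neq0.
Qed.

Lemma smooth_null_metric i j : smooth V (fun u => G u i j).
Proof.
have s0 := smooth_partial 0 y_smooth; have s1 := smooth_partial 1 y_smooth.
move: i j; apply: ord2P; apply: ord2P.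
- by apply: eq_smooth (smooth_cst V 0) => // u _; rewrite null_metricE.
- by apply: eq_smooth s0 => // u _; rewrite null_metricE.
- by apply: eq_smooth s0 => // u _; rewrite null_metricE.
- apply: (eq_smooth (f := fun u => 2 * d 1 y u)) => //.
    by move=> u _; rewrite null_metricE.
  by apply: smoothM => //; exact: smooth_cst.
Qed.

Lemma tr_null_metric u : (G u)^T = G u.
Proof.
by apply/matrixP; apply: ord2P; apply: ord2P; rewrite mxE !null_metricE.
Qed.

(** The functions y and u^2 are flat coordinates, so their covariant Hessians vanish: this reads
    y_sk = Gamma^1_sk y_1 and Gamma^2_sk = 0. *)
Lemma christoffel_null_metric j s k u : V u ->
  christoffel G j s k u = if j == 0 then (d 0 y u)^-1 * d s (d k y) u else 0.
Proof.
move=> Vu; have uG : G u \in unitmx by rewrite unitmxE unitfE det_null_metric.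
have y0 := y0_neq0 Vu.
have XG i l : invmx (G u) i 0 * G u 0 l + invmx (G u) i 1 * G u 1 l = (i == l)%:R.
  by rewrite -mulmx2E mulVmx // mxE.
have X01 : invmx (G u) 0 1 = (d 0 y u)^-1.
  have := XG 0 0; rewrite !null_metricE mulr0 add0r => E.
  by apply: (mulIf y0); rewrite mulVf // E.
have X11 : invmx (G u) 1 1 = 0.
  have := XG 1 0; rewrite !null_metricE mulr0 add0r => E.
  by apply: (mulIf y0); rewrite mul0r E.
have d00 i : d i (fun v => G v 0 0) u = 0.
  rewrite (_ : (fun v => G v 0 0) = fun=> 0) ?partial_cst //.
  by apply/funext => v; rewrite null_metricE.
have d01 i : d i (fun v => G v 0 1) u = d i (d 0 y) u.
  rewrite (_ : (fun v => G v 0 1) = d 0 y) //.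
  by apply/funext => v; rewrite null_metricE.
have d10 i : d i (fun v => G v 1 0) u = d i (d 0 y) u.
  rewrite (_ : (fun v => G v 1 0) = d 0 y) //.
  by apply/funext => v; rewrite null_metricE.
have d11 i : d i (fun v => G v 1 1) u = 2 * d i (d 1 y) u.
  rewrite (_ : (fun v => G v 1 1) = fun v => 2 * d 1 y v); last first.
    by apply/funext => v; rewrite null_metricE.
  rewrite partialM ?partial_cst ?mul0r ?addr0 //.
  exact: smooth_derivable (smooth_partial 1 y_smooth) Vu.
have S01 := partialC 0 1 V_open y_smooth Vu.
(* Here and in [lower1] stand twice the Christoffel symbols of the first kind, namely 0 and 2
   y_sk. *)
have lower0 s' k' : d s' (fun v => G v 0 k') u + d k' (fun v => G v 0 s') u
    - d 0 (fun v => G v s' k') u = 0.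
  by move: s' k'; apply: ord2P; apply: ord2P;
    rewrite ?d00 ?d01 ?d10 ?d11 -?S01; ring.
have lower1 s' k' : d s' (fun v => G v 1 k') u + d k' (fun v => G v 1 s') u
    - d 1 (fun v => G v s' k') u = 2 * d s' (d k' y) u.
  by move: s' k'; apply: ord2P; apply: ord2P;
    rewrite ?d00 ?d01 ?d10 ?d11 -?S01; ring.
rewrite /christoffel sum_ord2 lower0 lower1 mulr0 add0r.
move: j; apply: ord2P => /=; rewrite ?X01 ?X11; first by field.
by rewrite mul0r mulr0.
Qed.

(** For upper index 0, the third derivatives of y cancel by symmetry, and the terms from
    differentiating 1 / y_1 cancel the quadratic ones. For upper index 1 all symbols vanish. *)
Lemma flat_null_metric : flat_metric V G.
Proof.
have c0 s t v : V v -> christoffel G 0 s t v = (d 0 y v)^-1 * d s (d t y) v.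
  by move=> Vv; rewrite christoffel_null_metric.
have c1 s t v : V v -> christoffel G 1 s t v = 0.
  by move=> Vv; rewrite christoffel_null_metric.
move=> u Vu l i j k; rewrite /riemann sum_ord2.
move: c0 c1; move: (christoffel G) => Gamma c0 c1; move: l; apply: ord2P; last first.
  rewrite (eq_partial j V_open (c1 k i) Vu) (eq_partial k V_open (c1 j i) Vu).
  by rewrite !c1 // !partial_cst !mul0r subrr !addr0.
have y0 := y0_neq0 Vu.
have s2 s t : smooth V (d s (d t y)) by do 2 apply: smooth_partial.
have s1 t : smooth V (d t y) by exact: smooth_partial.
have sV : smooth V (fun v => (d 0 y v)^-1) by exact: smoothV.
have E a s t : d a (Gamma 0 s t) u =
    (d 0 y u)^-1 * d a (d s (d t y)) u
    - (d 0 y u) ^- 2 * d a (d 0 y) u * d s (d t y) u.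
  rewrite (eq_partial a V_open (c0 s t) Vu).
  rewrite (partialM (smooth_derivable sV Vu) (smooth_derivable (s2 s t) Vu)).
  by rewrite partialV ?mulNr //; exact: smooth_derivable (s1 0) Vu.
rewrite !E (partialC j k V_open (s1 i) Vu) (c1 k i u Vu) (c1 j i u Vu).
rewrite !(fun s t => c0 s t u Vu).
have cancel (Y a b c p q r r' : R) : Y != 0 ->
    Y^-1 * a - Y ^- 2 * c * p - (Y^-1 * a - Y ^- 2 * b * q) +
    (Y^-1 * c * (Y^-1 * p) - Y^-1 * b * (Y^-1 * q) +
    (Y^-1 * r * 0 - Y^-1 * r' * 0)) = 0.
  by move=> Y0; field.
exact: cancel y0.
Qed.

Definition null_density (u : 'rV[R]_2) : R := y u * L u + K u.

Lemma smooth_null_density : smooth V null_density.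
Proof. by apply: smoothD => //; exact: smoothM. Qed.

(** Since y and u^2 have zero covariant Hessian, that of y L + K is 2 dy dL + (y L'' + K'')
    (du^2)^2. With L' = lambda, its last diagonal entry agrees with that of G A by the equation for
    K''; the other entries agree directly. *)
Lemma covariant_hessian_null_metric u : V u ->
  covariant_hessian G null_density u = G u *m jordan_mx lam mu u.
Proof.
move=> Vu; have D f i v : smooth V f -> V v -> derivable f v (delta_mx 0 i : 'rV[R]_2).
  exact: smooth_derivable.
have dh s v : V v -> d s null_density v = y v * d s L v + d s y v * L v + d s K v.
  move=> Vv; rewrite partialD; first by rewrite partialM //; exact: D.
    by apply: D => //; exact: smoothM.
  exact: D.
have sy s := smooth_partial s y_smooth; have sL s := smooth_partial s L_smooth.
have sK s := smooth_partial s K_smooth.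
have ddh k s : d k (d s null_density) u =
    y u * d k (d s L) u + d k y u * d s L u
    + (d s y u * d k L u + d k (d s y) u * L u) + d k (d s K) u.
  have s1 : smooth V (fun v => y v * d s L v) by exact: smoothM.
  have s2 : smooth V (fun v => d s y v * L v) by exact: smoothM.
  have s3 : smooth V (fun v => y v * d s L v + d s y v * L v) by exact: smoothD.
  rewrite (eq_partial _ V_open (dh s) Vu).
  rewrite (partialD (D _ k u s3 Vu) (D _ k u (sK s) Vu)).
  rewrite (partialD (D _ k u s1 Vu) (D _ k u s2 Vu)).
  rewrite (partialM (D _ k u y_smooth Vu) (D _ k u (sL s) Vu)).
  by rewrite (partialM (D _ k u (sy s) Vu) (D _ k u L_smooth Vu)).
have y0 := y0_neq0 Vu.
have L00 k : d k (d 0 L) u = 0 by rewrite (eq_partial _ V_open L0 Vu) partial_cst.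
have L01 k : d k (d 1 L) u = d k lam u by exact: (eq_partial _ V_open L1 Vu).
have K00 k : d k (d 0 K) u = 0 by rewrite (eq_partial _ V_open K0 Vu) partial_cst.
have K01 : d 0 (d 1 K) u = 0 by rewrite (partialC _ _ V_open K_smooth Vu).
have H s k : covariant_hessian G null_density u s k =
    y u * d k (d s L) u + d k y u * d s L u + d s y u * d k L u + d k (d s K) u.
  rewrite mxE sum_ord2 !(christoffel_null_metric _ _ _ Vu) /= ddh (dh 0 u Vu).
  rewrite (L0 Vu) (K0 Vu) (partialC s k V_open y_smooth Vu).
  have cancel (Y a b c e f l m w : R) : Y != 0 ->
      a + b + (c + e * l) + f - (Y^-1 * e * (m * 0 + Y * l + 0) + 0 * w) =
      a + b + c + f by move=> Y0; field.
  exact: cancel y0.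
apply/matrixP; apply: ord2P; apply: ord2P;
  rewrite H mulmx2E !null_metricE !jordan_mxE ?L00 ?L01 ?K00 ?K01 ?K11 //
    ?L0 ?L1 ?lam0 //; ring.
Qed.

End Sufficiency.

(** * The equivalence of the three conditions *)

Theorem theorem6 (R : realType) (U : set 'rV[R]_2) (lam mu : 'rV[R]_2 -> R)
    (U_open : open U) (lam_smooth : smooth U lam) (mu_smooth : smooth U mu)
    (mu_neq0 : forall u, U u -> mu u != 0) :
  (linearly_degenerate U (jordan_mx lam mu) <->
   admits_quasilinear_constraint U lam mu) /\
  (linearly_degenerate U (jordan_mx lam mu) <->
   admits_dn_hamiltonian U (jordan_mx lam mu)).
Proof.
have ldP := linearly_degenerateP lam_smooth mu_neq0.
split; split.
- by move/ldP; exact: quasilinear_constraint_exists.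
- by move=> ac; apply/ldP => u; exact: quasilinear_constraint_partial0 ac.
- move/ldP => lam0 u0 Uu0.
  have [V [oV Vu0 VU [y [L [K [sy sL sK yLK]]]]]] :=
    jordan_potentials U_open lam_smooth mu_smooth mu_neq0 lam0 Uu0.
  have y0 u : V u -> partial 0 y u != 0 by case/yLK.
  have L0 u : V u -> partial 0 L u = 0 by case/yLK.
  have L1 u : V u -> partial 1 L u = lam u by case/yLK.
  have K0 u : V u -> partial 0 K u = 0 by case/yLK.
  have K11 u : V u -> partial 1 (partial 1 K) u =
      mu u * partial 0 y u - partial 1 lam u * y u by case/yLK.
  have lam0V u : V u -> partial 0 lam u = 0 by move/VU; exact: lam0.
  have uG u : V u -> null_metric y u \in unitmx.
    by move=> Vu; rewrite unitmxE unitfE (det_null_metric y0 Vu).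
  pose g u := invmx (null_metric y u).
  (* [invmx] is an involution on singular matrices too, so this is an equality of functions and not
     only one on [V]. *)
  have gE : (fun u => invmx (g u)) = null_metric y.
    by apply/funext => u; exact: invmxK.
  pose b u i j k := - \sum_s g u i s * christoffel (fun v => invmx (g v)) j s k u.
  exists V; split=> //; exists g, b, (null_density y L K); split.
  + split=> //.
    * apply: smooth_invmx => //; first exact: smooth_null_metric.
      exact: det_null_metric.
    * by move=> u Vu; rewrite -unitfE -unitmxE unitmx_inv uG.
    * by move=> u Vu; rewrite trmx_inv tr_null_metric.
    * by rewrite gE; exact: flat_null_metric.
  + exact: smooth_null_density.
  + move=> u p Vu i.
    apply: (@dn_flowP R 2 g b _ (jordan_mx lam mu u) u _).2 => //.
    rewrite gE (covariant_hessian_null_metric oV sy sL sK y0 L0 L1 K0 K11 lam0V Vu).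
    by rewrite mulmxA mulVmx ?mul1mx // uG.
- move=> ham; apply/ldP => u Uu.
  have [V [oV Vu VU [g [b [h [hamg sh flow]]]]]] := ham u Uu.
  apply: (hamiltonian_partial0 oV (sub_smooth VU lam_smooth) _ hamg sh flow Vu).
  by move=> v /VU; exact: mu_neq0.
Qed.
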